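(* Let $h$ be a bounded, self-adjoint, translation invariant operator in $\ell^2(\mathbb{Z})$, let $Q:\{0,1,2,\dots\}\to\mathbb{R}$ satisfy $\lim_{r\to\infty}Q(r)=0$, and for $N\in\mathbb{N}$ let $H_N=\sum_{i=1}^Nh_i+\sum_{1\le i<j\le N}Q_{ij}$ on $\ell^2(\mathbb{Z}^N)$. Let $H_N^{(s)}$ and $H_N^{(a)}$ be the restrictions of $H_N$ to the symmetric subspace $\ell^2_s(\mathbb{Z}^N)$ and the antisymmetric subspace $\ell^2_a(\mathbb{Z}^N)$, respectively. Then for all $m\in\{1,\dots,N-1\}$, $$\sigma(H_m^{(s)})+\sigma(H_{N-m}^{(s)})\subset\sigma(H_N^{(s)})$$ and $$\sigma(H_m^{(a)})+\sigma(H_{N-m}^{(a)})\subset\sigma(H_N^{(a)}).$$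
   Context: Translation invariance of $h$ means $[h,T_x]=0$ for all $x\in\mathbb{Z}$, where $(T_xf)(y)=f(y-x)$. On $\ell^2(\mathbb{Z}^N)=\bigotimes^N\ell^2(\mathbb{Z})$, $h_i$ acts as $h$ on the $i$-th tensor component and as the identity on the other components, and $Q_{ij}$ is the multiplication operator by $Q_{ij}(z)=Q(|z_i-z_j|)$, $z\in\mathbb{Z}^N$. The same $h$ and $Q$ are used for all particle numbers. $\ell^2_s(\mathbb{Z}^N)$ (resp. $\ell^2_a(\mathbb{Z}^N)$) is the set of $f\in\ell^2(\mathbb{Z}^N)$ with $f(x_{\sigma(1)},\dots,x_{\sigma(N)})=f(x_1,\dots,x_N)$ (resp. $=\mathrm{sgn}(\sigma)f(x_1,\dots,x_N)$) for all permutations $\sigma\in S_N$; both subspaces are invariant under $H_N$. Spectra of restrictions are spectra as operators on the respective subspaces. For sets $A,B\subset\mathbb{R}$, $A+B=\{a+b:a\in A,b\in B\}$. *)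

(* Defs.v *)
From mathcomp Require Import all_boot all_order all_algebra perm.
From mathcomp Require Import complex.
From mathcomp Require Import all_classical all_reals all_analysis.

Set Implicit Arguments.
Unset Strict Implicit.
Unset Printing Implicit Defensive.

Import Order.TTheory GRing.Theory Num.Theory.
Import numFieldNormedType.Exports.

Local Open Scope classical_set_scope.
Local Open Scope ring_scope.

(** The complex Hilbert space [l^2(I)] is the predicate [l2] on the functions
    [I -> R[i]].  An operator on a subspace [V] of [l^2(I)] is a map on all
    functions [I -> R[i]] of which only the values on [V] are ever used: every
    notion below quantifies over elements of [V] (or of [l2]) only. *)
Section HilbertSpace.
Context {R : realType} {I : choiceType}.
Implicit Types (f g : I -> R[i]) (V : set (I -> R[i])).

Definition l2normsq f : \bar R :=
  (\esum_(i in [set: I]) (complex.Re `|f i| ^+ 2)%:E)%E.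

Definition l2 : set (I -> R[i]) := [set f | (l2normsq f < +oo)%E].

Definition l2norm f : R := Num.sqrt (fine (l2normsq f)).

(** Sum of an absolutely summable family, as the difference of the sums of the
    positive and negative parts; the value on other families is junk. *)
Definition rsum (a : I -> R) : R :=
  fine (\esum_(i in [set: I]) (Num.max (a i) 0)%:E)%E
  - fine (\esum_(i in [set: I]) (Num.max (- a i) 0)%:E)%E.

Definition csum (a : I -> R[i]) : R[i] :=
  Complex (rsum (fun i => complex.Re (a i))) (rsum (fun i => complex.Im (a i))).

Definition inner f g : R[i] := csum (fun i => (f i)^* * g i).

Definition bounded_operator V (A : (I -> R[i]) -> I -> R[i]) : Prop :=
  [/\ forall f, V f -> V (A f),
      forall (c : R[i]) f g, V f -> V g ->
        A (fun i => c * f i + g i) = (fun i => c * A f i + A g i)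
    & exists M : R, forall f, V f -> l2norm (A f) <= M * l2norm f].

(** For a bounded, everywhere defined operator, being self-adjoint means being
    its own adjoint with respect to the inner product. *)
Definition self_adjoint (A : (I -> R[i]) -> I -> R[i]) : Prop :=
  forall f g, l2 f -> l2 g -> inner (A f) g = inner f (A g).

(** [z] is in the resolvent set of the restriction of [A] to [V] when [A - z]
    has a bounded two-sided inverse [B] on [V]. *)
Definition resolvent_set V (A : (I -> R[i]) -> I -> R[i]) : set R[i] :=
  [set z | exists B : (I -> R[i]) -> I -> R[i],
    [/\ bounded_operator V B,
        forall f, V f -> B (fun i => A f i - z * f i) = f
      & forall f, V f -> (fun i => A (B f) i - z * B f i) = f]].

Definition spectrum V (A : (I -> R[i]) -> I -> R[i]) : set R[i] :=
  ~` resolvent_set V A.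

End HilbertSpace.

Section ManyBody.
Context {R : realType}.

Definition translation (x : int) (f : int -> R[i]) : int -> R[i] :=
  fun y => f (y - x).

Definition translation_invariant (h : (int -> R[i]) -> int -> R[i]) : Prop :=
  forall (x : int) (f : int -> R[i]), l2 f ->
    h (translation x f) = translation x (h f).

Definition config (N : nat) := {ffun 'I_N -> int}.

Definition update (N : nat) (z : config N) (i : 'I_N) (y : int) : config N :=
  [ffun k => if k == i then y else z k].

(** [1 (x) ... (x) h (x) ... (x) 1] with [h] in position [i]: freeze all the
    coordinates but the [i]-th one, and apply [h] to the resulting slice. *)
Definition one_body (N : nat) (h : (int -> R[i]) -> int -> R[i]) (i : 'I_N)
    (f : config N -> R[i]) : config N -> R[i] :=
  fun z => h (fun y => f (update z i y)) (z i).

Definition pair_potential (N : nat) (Q : nat -> R) (i j : 'I_N)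
    (f : config N -> R[i]) : config N -> R[i] :=
  fun z => (Q `|z i - z j|%N)%:C%C * f z.

Definition hamiltonian (h : (int -> R[i]) -> int -> R[i]) (Q : nat -> R)
    (N : nat) (f : config N -> R[i]) : config N -> R[i] :=
  fun z => \sum_(i < N) one_body h i f z
    + \sum_(i < N) \sum_(j < N | (i < j)%N) pair_potential Q i j f z.

Definition permute (N : nat) (s : 'S_N) (z : config N) : config N :=
  [ffun i => z (s i)].

Definition l2s (N : nat) : set (config N -> R[i]) :=
  [set f | l2 f /\ forall (s : 'S_N) (z : config N), f (permute s z) = f z].

Definition l2a (N : nat) : set (config N -> R[i]) :=
  [set f | l2 f /\ forall (s : 'S_N) (z : config N),
    f (permute s z) = (-1) ^+ s * f z].

End ManyBody.

Arguments hamiltonian {R} h Q N f.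
Arguments l2s {R} N.
Arguments l2a {R} N.

Definition sumset {R : realType} (A B : set R[i]) : set R[i] :=
  [set a + b | a in A & b in B].

(* Main.v *)
(** Both spectra consist of approximate eigenvalues, since the Hamiltonians are
    bounded and symmetric.  Given approximate eigenvectors [f] of [H_m] and [g]
    of [H_(N-m)], cut them off to finite boxes and translate [g] far away.  The
    interaction between the two clusters is then negligible, so [f (x) g] is an
    approximate eigenvector of [H_N] for the sum of the two eigenvalues.  After
    (anti)symmetrization over ['S_N], the permutations that mix the two clusters
    produce terms supported away from [f (x) g], while all the others reproduce
    [f (x) g] itself; hence the norm does not drop, and the (anti)symmetrized
    vector is an approximate eigenvector in the required sector. *)
Require Import Defs.
From mathcomp Require Import all_boot all_order all_algebra fingroup perm.
From mathcomp Require Import complex ring lra zify.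
From mathcomp Require Import all_classical all_reals all_analysis.

Set Implicit Arguments.
Unset Strict Implicit.
Unset Printing Implicit Defensive.

Import Order.TTheory GRing.Theory Num.Theory.
Import numFieldNormedType.Exports.
Local Open Scope classical_set_scope.
Local Open Scope ring_scope.

(** * Square-summable families *)

Section ComplexNorm.
Context {R : realType}.
Implicit Types x y c : R[i].

(** [resolvent_set] asks for a bounded two-sided inverse on the subspace, so the hard half of the
    approximate-eigenvalue criterion is surjectivity of an operator that is only known to be bounded
    below. This is settled for every complex [z] at once, without first showing that the spectrum is
    real: for a symmetric [A] the operator [D = A - z] is normal, and [D^* D], being strictly
    positive, can be inverted by a Neumann series. That is where completeness of [l2] enters, and
    closedness of the sectors keeps the limits inside them. A second obstacle is that [one_body]
    acts slice by slice: its bound comes from summing over parallel lines, and its symmetry from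
    matrix entries on point masses. Symmetrization costs a factor [#|'S_N|] in the error but nothing
    in the lower bound for the norm. The factor depends only on the number of particles, so it is
    absorbed by choosing the cluster states accurate enough beforehand. *)

Definition sqn x : R := complex.Re x ^+ 2 + complex.Im x ^+ 2.

(** This is the real part of [x^* * y]. Norms and real parts of inner products suffice below, so
    [l2] is treated as a real Hilbert space; complex scalars change sides through [rdotM_conj]. *)
Definition rdot x y : R :=
  complex.Re x * complex.Re y + complex.Im x * complex.Im y.

Lemma sqn_normE x : complex.Re `|x| ^+ 2 = sqn x.
Proof.
by case: x => a b; rewrite /sqn/= sqr_sqrtr// addr_ge0// sqr_ge0.
Qed.

Lemma sqn_ge0 x : 0 <= sqn x.
Proof. by rewrite addr_ge0// sqr_ge0. Qed.

Lemma sqn0 : sqn 0 = 0.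
Proof. by rewrite /sqn/= expr0n/= addr0. Qed.

Lemma sqn_eq0 x : (sqn x == 0) = (x == 0).
Proof. by rewrite eq_complex/= paddr_eq0 ?sqr_ge0// !sqrf_eq0. Qed.

Lemma sqnM x y : sqn (x * y) = sqn x * sqn y.
Proof. by case: x => a b; case: y => c d; rewrite /sqn/=; ring. Qed.

Lemma sqnN x : sqn (- x) = sqn x.
Proof. by case: x => a b; rewrite /sqn/=; ring. Qed.

Lemma sqnC (a : R) : sqn a%:C%C = a ^+ 2.
Proof. by rewrite /sqn/= expr0n addr0. Qed.

Lemma sqnD_le x y : sqn (x + y) <= 2 * (sqn x + sqn y).
Proof.
case: x => a b; case: y => c d; rewrite /sqn/=.
have := sqr_ge0 (a - c); have := sqr_ge0 (b - d); rewrite !expr2; nra.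
Qed.

Lemma rdot_le x y : `|rdot x y| <= sqn x + sqn y.
Proof.
case: x => a b; case: y => c d; rewrite /sqn /rdot/= !expr2.
have := sqr_ge0 (a - c); have := sqr_ge0 (b - d).
have := sqr_ge0 (a + c); have := sqr_ge0 (b + d); rewrite !expr2 => *.
by rewrite ler_norml; apply/andP; split; nra.
Qed.

Lemma rdotC x y : rdot x y = rdot y x.
Proof. by rewrite /rdot; ring. Qed.

Lemma rdot_conj x y : complex.Re (x^* * y) = rdot x y.
Proof. by case: x => a b; case: y => c d; rewrite /rdot/=; ring. Qed.

Lemma rdotM_conj c x y : rdot (c * x) y = rdot x (c^* * y).
Proof. by case: x => a b; case: y => d e; case: c => f g; rewrite /rdot/=; ring. Qed.

End ComplexNorm.

(** * Sums of real families *)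

Section Esum.
Context {R : realType} {I : choiceType}.
Implicit Types a b p n : I -> R.

Definition tsum a : \bar R := (\esum_(i in [set: I]) (a i)%:E)%E.

Arguments tsum a%_R.

Lemma tsum_ge0 a : (forall i, 0 <= a i) -> (0 <= tsum a)%E.
Proof. by move=> a0; apply: esum_ge0 => i _; rewrite lee_fin. Qed.

Lemma le_tsum a b : (forall i, a i <= b i) -> (tsum a <= tsum b)%E.
Proof. by move=> ab; apply: le_esum => i _; rewrite lee_fin. Qed.

Lemma tsumD a b : (forall i, 0 <= a i) -> (forall i, 0 <= b i) ->
  tsum (fun i => a i + b i) = (tsum a + tsum b)%E.
Proof.
by move=> a0 b0; rewrite /tsum -esumD//; move=> i _; rewrite lee_fin.
Qed.

Lemma tsum_fsetP a (x : \bar R) :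
  (forall s : seq I, uniq s -> (\sum_(i <- s) (a i)%:E <= x)%E) -> (tsum a <= x)%E.
Proof.
move=> H; apply: ge_ereal_sup => _ [X [finX _] <-].
rewrite fsbig_finite//=; exact: H.
Qed.

Lemma tsum_seq a (s : seq I) : (forall i, 0 <= a i) -> uniq s ->
  (\sum_(i <- s) (a i)%:E <= tsum a)%E.
Proof.
move=> a0 us; apply: esum_ge; exists [set` s]; first by split.
by rewrite fsbig_seq.
Qed.

Lemma tsumZ (c : R) a : 0 <= c -> (forall i, 0 <= a i) ->
  tsum (fun i => c * a i) = (c%:E * tsum a)%E.
Proof.
have le_ (d : R) b : 0 <= d -> (forall i, 0 <= b i) ->
    (tsum (fun i => (d * b i)%R) <= d%:E * tsum b)%E.
  move=> d0 b0; apply: tsum_fsetP => s us.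
  under eq_bigr do rewrite EFinM.
  rewrite -ge0_sume_distrr; last by move=> i _; rewrite lee_fin.
  by apply: lee_wpmul2l; rewrite ?lee_fin// tsum_seq.
move=> c0 a0; apply/eqP; rewrite eq_le le_//=.
have [->|cn0] := eqVneq c 0.
  by rewrite mul0e tsum_ge0// => i; rewrite mul0r.
have {cn0}c0 : 0 < c by rewrite lt_def cn0.
(* The reverse inequality is the one already proved, for the factor [c^-1] and the family
   [c * a]. *)
have := @le_ c^-1 (fun i => c * a i).
rewrite invr_ge0 (ltW c0) => /(_ isT (fun i => mulr_ge0 (ltW c0) (a0 i))).
rewrite (_ : (fun i => _) = a); last by apply/funext => i; rewrite mulKf ?gt_eqF.
move=> H; have {H} := lee_wpmul2l (ltW c0 : 0 <= c%:E)%E H.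
by rewrite muleA -EFinM mulfV ?gt_eqF// mul1e.
Qed.

Lemma fin_tsum a : (forall i, 0 <= a i) -> (tsum a < +oo)%E -> tsum a \is a fin_num.
Proof. by move=> a0 ?; rewrite ge0_fin_numE// tsum_ge0. Qed.

Definition asummable a := (tsum (fun i => `|a i|)%R < +oo)%E.

Lemma asummable_le a b : (forall i, `|a i| <= `|b i|) -> asummable b -> asummable a.
Proof. by move=> ab; apply: le_lt_trans; exact: le_tsum. Qed.

(** If [q] and [r] are the positive and negative parts of [p - n], then [q + n = r + p], and only
    nonnegative sums have to be compared. Being free to choose the splitting is what makes [rsum]
    linear, since positive parts are not additive. *)
Lemma rsumB_nneg p n : (forall i, 0 <= p i) -> (forall i, 0 <= n i) ->
  (tsum p < +oo)%E -> (tsum n < +oo)%E ->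
  rsum (fun i => p i - n i) = fine (tsum p) - fine (tsum n).
Proof.
move=> p0 n0 sp sn; rewrite /rsum.
set q := fun i => Num.max (p i - n i) 0; set r := fun i => Num.max (- (p i - n i)) 0.
have q0 i : 0 <= q i by rewrite /q le_max lexx orbT.
have r0 i : 0 <= r i by rewrite /r le_max lexx orbT.
have sq : (tsum q < +oo)%E.
  apply: le_lt_trans sp; apply: le_tsum => i.
  by rewrite /q ge_max p0 andbT gerBl.
have sr : (tsum r < +oo)%E.
  apply: le_lt_trans sn; apply: le_tsum => i.
  by rewrite /r ge_max n0 andbT opprB gerBl.
rewrite -/(tsum q) -/(tsum r).
have : tsum (fun i => q i + n i) = tsum (fun i => r i + p i).
  congr tsum; apply/funext => i; rewrite /q /r.
  by case: (leP (p i - n i) 0); case: (leP (- (p i - n i)) 0); lra.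
rewrite !tsumD// => /(congr1 fine).
by rewrite !fineD ?fin_tsum//; lra.
Qed.

Lemma max_abs_le (x : R) : Num.max x 0 <= `|x|.
Proof. by rewrite ge_max ler_norm normr_ge0. Qed.

Lemma rsum_lin (c : R) a b : asummable a -> asummable b ->
  rsum (fun i => c * a i + b i) = c * rsum a + rsum b.
Proof.
move=> sa sb.
have P0 (d : I -> R) i : 0 <= Num.max (d i) 0 by rewrite le_max lexx orbT.
have Psum (d : I -> R) : asummable d -> (tsum (fun i => Num.max (d i) 0)%R < +oo)%E.
  by apply: le_lt_trans; apply: le_tsum => i; exact: max_abs_le.
have Nsum (d : I -> R) : asummable d -> (tsum (fun i => Num.max (- d i) 0)%R < +oo)%E.
  move=> sd; apply: (Psum (fun i => - d i)); apply: asummable_le sd => i.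
  by rewrite normrN.
have dec (x : R) : x = Num.max x 0 - Num.max (- x) 0.
  by case: (leP x 0); case: (leP (- x) 0); lra.
have sZ (d : R) u : 0 <= d -> (forall i, 0 <= u i) -> (tsum u < +oo)%E ->
    (tsum (fun i => d * u i)%R < +oo)%E.
  by move=> d0 u0 su; rewrite tsumZ// lte_mul_pinfty// ?tsum_ge0// lee_fin.
pose ap i := Num.max (a i) 0; pose an i := Num.max (- a i) 0.
pose bp i := Num.max (b i) 0; pose bn i := Num.max (- b i) 0.
have bp0 i : 0 <= bp i by exact: P0.
have bn0 i : 0 <= bn i by exact: (P0 (fun i => - b i)).
have ap0 i : 0 <= ap i by exact: P0.
have an0 i : 0 <= an i by exact: (P0 (fun i => - a i)).
have sap : (tsum ap < +oo)%E by exact: Psum.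
have san : (tsum an < +oo)%E by exact: Nsum.
have sbp : (tsum bp < +oo)%E by exact: Psum.
have sbn : (tsum bn < +oo)%E by exact: Nsum.
have main (d : R) u v : 0 <= d -> (forall i, 0 <= u i) -> (forall i, 0 <= v i) ->
    (tsum u < +oo)%E -> (tsum v < +oo)%E ->
    rsum (fun i => d * (u i - v i) + b i) =
    d * (fine (tsum u) - fine (tsum v)) + rsum b.
  move=> d0 u0 v0 su sv.
  have -> : (fun i => d * (u i - v i) + b i) =
            (fun i => (d * u i + bp i) - (d * v i + bn i)).
    by apply/funext => i; rewrite {1}(dec (b i)) -/(bp i) -/(bn i); ring.
  have dp0 i : 0 <= d * u i by rewrite mulr_ge0.
  have dn0 i : 0 <= d * v i by rewrite mulr_ge0.
  have sp : (tsum (fun i => d * u i)%R < +oo)%E by exact: sZ.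
  have sn : (tsum (fun i => d * v i)%R < +oo)%E by exact: sZ.
  rewrite rsumB_nneg.
  - rewrite !tsumD// !fineD ?fin_tsum// !tsumZ// !fineM ?fin_tsum// /rsum/=.
    by rewrite -/(tsum bp) -/(tsum bn); ring.
  - by move=> i; rewrite addr_ge0.
  - by move=> i; rewrite addr_ge0.
  - by rewrite tsumD// lte_add_pinfty.
  - by rewrite tsumD// lte_add_pinfty.
have ra : rsum a = fine (tsum ap) - fine (tsum an) by [].
have [c0|c0] := leP 0 c.
  rewrite ra -main//.
  by congr rsum; apply/funext => i; rewrite {1}(dec (a i)).
(* A negative factor exchanges the roles of the positive and negative parts. *)
have -> : c * rsum a = (- c) * (fine (tsum an) - fine (tsum ap)).
  by rewrite ra; ring.
rewrite -main//; last by lra.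
by congr rsum; apply/funext => i; rewrite {1}(dec (a i)) -/(ap i) -/(an i); ring.
Qed.

Lemma rsum_nneg a : (forall i, 0 <= a i) -> rsum a = fine (tsum a).
Proof.
move=> a0; rewrite /rsum.
have -> : (fun i => (Num.max (a i) 0)%:E) = (fun i => (a i)%:E).
  by apply/funext => i; rewrite max_l.
have -> : (fun i => (Num.max (- a i) 0)%:E) = (fun i => 0%E).
  by apply/funext => i; rewrite max_r// oppr_le0.
by rewrite [X in _ - fine X]esum1//= subr0.
Qed.

End Esum.

(** * Norm, real inner product and Cauchy-Schwarz *)

Section L2.
Context {R : realType} {I : choiceType}.
Implicit Types (f g k : I -> R[i]) (c : R[i]).

Definition nsq f : R := fine (l2normsq f).

Definition rin f g : R := rsum (fun i => rdot (f i) (g i)).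

Lemma l2normsqE f : l2normsq f = tsum (fun i => sqn (f i)).
Proof. by apply: eq_esum => i _; rewrite sqn_normE. Qed.

Lemma l2_nsq f : l2 f -> l2normsq f = (nsq f)%:E.
Proof.
move=> f2; rewrite /nsq fineK// l2normsqE fin_tsum -?l2normsqE// => i.
exact: sqn_ge0.
Qed.

Lemma nsq_ge0 f : 0 <= nsq f.
Proof. by rewrite fine_ge0// l2normsqE tsum_ge0// => i; exact: sqn_ge0. Qed.

Lemma l2norm_ge0 f : 0 <= l2norm f.
Proof. exact: sqrtr_ge0. Qed.

Lemma sqr_l2norm f : l2norm f ^+ 2 = nsq f.
Proof. by rewrite sqr_sqrtr// nsq_ge0. Qed.

Lemma l2_le f g : (forall i, sqn (f i) <= sqn (g i)) -> l2 g -> l2 f.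
Proof.
move=> fg; apply: le_lt_trans; rewrite !l2normsqE; exact: le_tsum.
Qed.

Lemma nsq_le f g : (forall i, sqn (f i) <= sqn (g i)) -> l2 g -> nsq f <= nsq g.
Proof.
move=> fg g2; rewrite -lee_fin -!l2_nsq//; last exact: l2_le g2.
by rewrite !l2normsqE; exact: le_tsum.
Qed.

Lemma l2norm_le f g :
  (forall i, sqn (f i) <= sqn (g i)) -> l2 g -> l2norm f <= l2norm g.
Proof. by move=> fg g2; rewrite ler_wsqrtr// nsq_le. Qed.

Lemma l2normsq0 : l2normsq (fun _ : I => 0 : R[i]) = 0%E.
Proof. by rewrite l2normsqE /tsum esum1// => i _; rewrite sqn0. Qed.

Lemma l2_0 : l2 (fun _ : I => 0 : R[i]).
Proof. by rewrite /l2/= l2normsq0 ltry. Qed.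

Lemma l2norm0 : l2norm (fun _ : I => 0 : R[i]) = 0.
Proof. by rewrite /l2norm l2normsq0 sqrtr0. Qed.

Lemma l2normsqZ c f : l2normsq (fun i => c * f i) = ((sqn c)%:E * l2normsq f)%E.
Proof.
rewrite !l2normsqE -tsumZ ?sqn_ge0//; last by move=> i; exact: sqn_ge0.
by congr tsum; apply/funext => i; rewrite sqnM.
Qed.

Lemma l2Z c f : l2 f -> l2 (fun i => c * f i).
Proof.
by move=> f2; rewrite /l2/= l2normsqZ l2_nsq// -EFinM ltry.
Qed.

Lemma nsqZ c f : l2 f -> nsq (fun i => c * f i) = sqn c * nsq f.
Proof. by move=> f2; rewrite /nsq l2normsqZ l2_nsq. Qed.

Lemma l2normZ c f : l2 f -> l2norm (fun i => c * f i) = Num.sqrt (sqn c) * l2norm f.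
Proof.
by move=> f2; rewrite /l2norm -/(nsq _) nsqZ// sqrtrM ?sqn_ge0.
Qed.

Lemma l2D f g : l2 f -> l2 g -> l2 (fun i => f i + g i).
Proof.
move=> f2 g2; rewrite /l2/= l2normsqE.
apply: (@le_lt_trans _ _ (tsum (fun i => 2 * (sqn (f i) + sqn (g i))))).
  by apply: le_tsum => i; exact: sqnD_le.
rewrite tsumZ//; last by move=> i; rewrite addr_ge0 ?sqn_ge0.
rewrite tsumD; try by move=> i; exact: sqn_ge0.
by rewrite -!l2normsqE !l2_nsq// -EFinD -EFinM ltry.
Qed.

Lemma l2_lin c f g : l2 f -> l2 g -> l2 (fun i => c * f i + g i).
Proof. by move=> f2 g2; apply: l2D => //; exact: l2Z. Qed.

Lemma l2N f : l2 f -> l2 (fun i => - f i).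
Proof. by apply: l2_le => i; rewrite sqnN. Qed.

Lemma l2B f g : l2 f -> l2 g -> l2 (fun i => f i - g i).
Proof. by move=> f2 g2; apply: (l2D (g := fun i => - g i)) => //; exact: l2N. Qed.

Lemma asummable_rdot f g : l2 f -> l2 g -> asummable (fun i => rdot (f i) (g i)).
Proof.
move=> f2 g2; apply: (@le_lt_trans _ _ (tsum (fun i => sqn (f i) + sqn (g i)))).
  by apply: le_tsum => i; exact: rdot_le.
rewrite tsumD; try by move=> i; exact: sqn_ge0.
by rewrite -!l2normsqE !l2_nsq// -EFinD ltry.
Qed.

Lemma rinC f g : rin f g = rin g f.
Proof. by congr rsum; apply/funext => i; rewrite rdotC. Qed.

Lemma rinff f : rin f f = nsq f.
Proof.
rewrite /nsq l2normsqE -rsum_nneg; last by move=> i; exact: sqn_ge0.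
by congr rsum; apply/funext => i; rewrite /rdot /sqn; ring.
Qed.

Lemma rin0r f : rin f (fun=> 0) = 0.
Proof.
rewrite /rin (_ : (fun i => _) = (fun=> 0)).
  by rewrite rsum_nneg// /tsum esum1.
by apply/funext => i; rewrite /rdot !mulr0 addr0.
Qed.

Lemma rin_re f g : complex.Re (inner f g) = rin f g.
Proof. by congr rsum; apply/funext => i; rewrite rdot_conj. Qed.

Lemma rinZ_conj c f g :
  rin (fun i => c * f i) g = rin f (fun i => c^* * g i).
Proof. by congr rsum; apply/funext => i; rewrite rdotM_conj. Qed.

Lemma rin_linr (a : R) f g k : l2 f -> l2 g -> l2 k ->
  rin f (fun i => a%:C%C * g i + k i) = a * rin f g + rin f k.
Proof.
move=> f2 g2 k2; rewrite -rsum_lin; try exact: asummable_rdot.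
congr rsum; apply/funext => i; rewrite /rdot.
by case: (f i) (g i) (k i) => [x y] [z t] [u v]/=; ring.
Qed.

Lemma rinDr f g k : l2 f -> l2 g -> l2 k ->
  rin f (fun i => g i + k i) = rin f g + rin f k.
Proof.
move=> f2 g2 k2; rewrite -[X in X + _]mul1r -rin_linr//.
by congr rin; apply/funext => i; rewrite mul1r.
Qed.

Lemma rinBr f g k : l2 f -> l2 g -> l2 k ->
  rin f (fun i => g i - k i) = rin f g - rin f k.
Proof.
move=> f2 g2 k2; rewrite addrC -mulN1r -rin_linr//.
by congr rin; apply/funext => i; rewrite rmorphN rmorph1 mulN1r addrC.
Qed.

Lemma rinZr (a : R) f g : l2 f -> l2 g ->
  rin f (fun i => a%:C%C * g i) = a * rin f g.
Proof.
move=> f2 g2; have := rin_linr a f2 g2 l2_0; rewrite rin0r addr0 => <-; congr rin.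
by apply/funext => i; rewrite addr0.
Qed.

Lemma rinDl f g k : l2 f -> l2 g -> l2 k ->
  rin (fun i => f i + g i) k = rin f k + rin g k.
Proof. by move=> *; rewrite rinC rinDr// !(rinC k). Qed.

Lemma rinBl f g k : l2 f -> l2 g -> l2 k ->
  rin (fun i => f i - g i) k = rin f k - rin g k.
Proof. by move=> *; rewrite rinC rinBr// !(rinC k). Qed.

Lemma nsqD f g : l2 f -> l2 g ->
  nsq (fun i => f i + g i) = nsq f + 2 * rin f g + nsq g.
Proof.
move=> f2 g2; rewrite -!rinff rinDl ?rinDr//; try exact: l2D.
by rewrite (rinC g f); ring.
Qed.

Lemma rin_sqr_le f g : l2 f -> l2 g -> rin f g ^+ 2 <= nsq f * nsq g.
Proof.
move=> f2 g2.
have H t : 0 <= nsq f + 2 * (t * rin f g) + t ^+ 2 * nsq g.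
  by rewrite -sqnC -nsqZ// -rinZr// -nsqD ?nsq_ge0//; exact: l2Z.
have gg0 := nsq_ge0 g; have ff0 := nsq_ge0 f.
have [g0|gn0] := eqVneq (nsq g) 0; last first.
  have gp : 0 < nsq g by rewrite lt_def gn0.
  (* This is the minimizer of the quadratic polynomial in [t]. *)
  have := H (- rin f g / nsq g).
  rewrite (_ : _ + _ + _ = (nsq f * nsq g - rin f g ^+ 2) / nsq g).
    by rewrite pmulr_lge0 ?invr_gt0// subr_ge0.
  by field.
have [->|rn0] := eqVneq (rin f g) 0; first by rewrite expr0n/= mulr_ge0.
(* When [nsq g = 0] the polynomial is affine in [t] with nonzero slope; this [t] gives it the
   negative value [- nsq f - 2]. *)
have := H (- (nsq f + 1) / rin f g); rewrite g0.
rewrite (_ : _ + _ + _ = - nsq f - 2); last by field.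
by move=> ?; exfalso; lra.
Qed.

Lemma rin_le f g : l2 f -> l2 g -> `|rin f g| <= l2norm f * l2norm g.
Proof.
move=> f2 g2; rewrite -(@ler_pXn2r _ 2) ?nnegrE ?mulr_ge0 ?l2norm_ge0//.
by rewrite real_normK ?num_real// exprMn !sqr_l2norm rin_sqr_le.
Qed.

Lemma l2norm_triangle f g : l2 f -> l2 g ->
  l2norm (fun i => f i + g i) <= l2norm f + l2norm g.
Proof.
move=> f2 g2.
rewrite -(@ler_pXn2r _ 2) ?nnegrE ?addr_ge0 ?l2norm_ge0//.
rewrite sqrrD !sqr_l2norm nsqD// lerD2r lerD2l mulr2n.
by have := le_trans (ler_norm _) (rin_le f2 g2); lra.
Qed.

Lemma l2normN f : l2norm (fun i => - f i) = l2norm f.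
Proof.
by rewrite /l2norm !l2normsqE; congr (Num.sqrt (fine (tsum _)));
  apply/funext => i; rewrite sqnN.
Qed.

Lemma l2norm_triangleB f g : l2 f -> l2 g ->
  l2norm (fun i => f i - g i) <= l2norm f + l2norm g.
Proof.
move=> f2 g2; rewrite -(l2normN g).
by apply: (l2norm_triangle (g := fun i => - g i)) => //; exact: l2N.
Qed.

Lemma l2norm_subC f g : l2norm (fun i => f i - g i) = l2norm (fun i => g i - f i).
Proof. by rewrite -l2normN; congr l2norm; apply/funext => i; rewrite opprB. Qed.

Lemma sqn_le_nsq f i : l2 f -> sqn (f i) <= nsq f.
Proof.
move=> f2; rewrite -lee_fin -l2_nsq// l2normsqE.
have := @tsum_seq _ _ (fun i => sqn (f i)) [:: i] (fun j => sqn_ge0 _) isT.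
by rewrite big_seq1.
Qed.

Lemma l2norm_eq0 f : l2 f -> l2norm f = 0 -> f = (fun=> 0).
Proof.
move=> f2 f0; apply/funext => i; apply/eqP; rewrite -sqn_eq0.
by rewrite eq_le sqn_ge0 andbT (le_trans (sqn_le_nsq i f2))// -sqr_l2norm f0 expr0n.
Qed.

End L2.

(** * Finite truncations, density and completeness *)

Section Cut.
Context {R : realType} {I : choiceType}.
Implicit Types (f g : I -> R[i]) (D E : pred I) (s : seq I).

Definition cutoff D f : I -> R[i] := fun i => if D i then f i else 0.

Lemma sqn_cut_le D f i : sqn (cutoff D f i) <= sqn (f i).
Proof. by rewrite /cutoff; case: ifP; rewrite ?sqn0 ?sqn_ge0. Qed.

Lemma l2_cut D f : l2 f -> l2 (cutoff D f).
Proof. by apply: l2_le => i; exact: sqn_cut_le. Qed.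

Lemma tsum_seqE (a : I -> R) s : (forall i, 0 <= a i) -> uniq s ->
  tsum (fun i => if i \in s then a i else 0) = (\sum_(i <- s) a i)%:E.
Proof.
move=> a0 us; have := @esum_mkcond R I [set` s] (fun i => (a i)%:E).
rewrite esum_fset//; last by move=> i _; rewrite lee_fin.
rewrite -fsbig_seq// -sumEFin => ->; apply: eq_esum => i _.
by rewrite mem_setE; case: ifP.
Qed.

Lemma l2normsq_cut_seq s f : uniq s ->
  l2normsq (cutoff (mem s) f) = (\sum_(i <- s) sqn (f i))%:E.
Proof.
move=> us; rewrite l2normsqE -tsum_seqE//; last by move=> i; exact: sqn_ge0.
by congr tsum; apply/funext => i; rewrite /cutoff/=; case: ifP; rewrite ?sqn0.
Qed.

Lemma l2_cut_seq s f : uniq s -> l2 (cutoff (mem s) f).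
Proof. by move=> us; rewrite /l2/= l2normsq_cut_seq// ltry. Qed.

Lemma l2norm_cut_le f (x : R) : 0 <= x ->
  (forall s, uniq s -> l2norm (cutoff (mem s) f) <= x) -> l2 f /\ l2norm f <= x.
Proof.
move=> x0 H.
have le_f : (l2normsq f <= (x ^+ 2)%:E)%E.
  rewrite l2normsqE; apply: tsum_fsetP => s us.
  rewrite sumEFin -l2normsq_cut_seq// l2_nsq; last exact: l2_cut_seq.
  by rewrite lee_fin -sqr_l2norm ler_pXn2r ?nnegrE ?l2norm_ge0// H.
have f2 : l2 f by apply: le_lt_trans le_f _; rewrite ltry.
split=> //; rewrite -(@ler_pXn2r _ 2) ?nnegrE ?l2norm_ge0//.
by rewrite sqr_l2norm -lee_fin -l2_nsq.
Qed.

(** If every finite set left a tail of norm above [e], every finite partial sum would stay below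
    [nsq f - e ^+ 2], and so would their supremum [nsq f]. *)
Lemma l2_tail f (e : R) : l2 f -> 0 < e ->
  exists2 s, uniq s & l2norm (fun i => f i - cutoff (mem s) f i) <= e.
Proof.
move=> f2 e0; apply: contrapT => /forall2NP H.
suff : (l2normsq f <= (nsq f - e ^+ 2)%:E)%E.
  rewrite l2_nsq// lee_fin => ?.
  have : 0 < e ^+ 2 by rewrite exprn_gt0.
  by lra.
rewrite l2normsqE; apply: tsum_fsetP => s us.
have [/(_ us)//|] := H s.
move=> /negP; rewrite -ltNge => es.
rewrite sumEFin lee_fin.
have gc i : (f i - cutoff (mem s) f i) = cutoff (predC (mem s)) f i.
  by rewrite /cutoff/=; case: ifP => /=; rewrite ?subrr ?subr0.
have : e ^+ 2 <= nsq (fun i => f i - cutoff (mem s) f i).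
  by rewrite -sqr_l2norm ler_pXn2r ?nnegrE ?l2norm_ge0// ltW.
rewrite (_ : nsq f = nsq (fun i => f i - cutoff (mem s) f i) +
   \sum_(i <- s) sqn (f i)); first by lra.
apply: EFin_inj; rewrite EFinD -l2normsq_cut_seq// -!l2_nsq//; last first.
  by apply: l2B => //; exact: l2_cut.
rewrite !l2normsqE -tsumD; try by move=> i; exact: sqn_ge0.
congr tsum; apply/funext => i; rewrite gc /cutoff/=.
by case: (i \in s) => /=; rewrite sqn0 ?add0r ?addr0.
Qed.

Definition delta (x : I) (c : R[i]) : I -> R[i] := fun i => if i == x then c else 0.

Lemma deltaE x c : delta x c = cutoff (mem [:: x]) (fun=> c).
Proof. by apply/funext => i; rewrite /delta /cutoff/= inE. Qed.

Lemma l2_delta x c : l2 (delta x c).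
Proof. by rewrite deltaE; exact: l2_cut_seq. Qed.

Lemma rin_delta f x c : rin f (delta x c) = rdot (f x) c.
Proof.
pose g := delta x c.
have -> : rin f g = rsum (fun i => Num.max (rdot (f i) (g i)) 0 -
                                   Num.max (- rdot (f i) (g i)) 0).
  congr rsum; apply/funext => i.
  by case: (leP (rdot (f i) (g i)) 0); case: (leP (- rdot (f i) (g i)) 0); lra.
have one (a : I -> R) : (forall i, 0 <= a i) -> (forall i, i != x -> a i = 0) ->
    tsum a = (a x)%:E.
  move=> a0 ax; rewrite -[a x](big_seq1 +%R x a) -tsum_seqE//.
  congr tsum; apply/funext => i; rewrite inE; case: eqP => // /eqP; exact: ax.
have g0 i : i != x -> rdot (f i) (g i) = 0.
  by rewrite /g /delta => /negPf ->; rewrite /rdot !mulr0 addr0.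
have P0 (y : R) : 0 <= Num.max y 0 by rewrite le_max lexx orbT.
rewrite rsumB_nneg//; rewrite ?one ?ltry//=;
  try by move=> i /g0 ->; rewrite ?oppr0 maxxx.
rewrite {1 2}/g /delta eqxx.
by case: (leP (rdot (f x) c) 0); case: (leP (- rdot (f x) c) 0); lra.
Qed.

(** Density of finitely supported functions as an induction principle: points are added one at a
    time, and the last premise passes to limits. *)
Lemma l2_ind (P : set (I -> R[i])) :
  P (fun=> 0) ->
  (forall f x c, l2 f -> P f -> P (fun i => delta x c i + f i)) ->
  (forall f, l2 f ->
    (forall e : R, 0 < e -> exists g, [/\ l2 g, P g &
      l2norm (fun i => f i - g i) <= e]) -> P f) ->
  forall f, l2 f -> P f.
Proof.
move=> P0 PD Pcl f f2; apply: Pcl => // e e0.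
have [s us es] := l2_tail f2 e0; exists (cutoff (mem s) f); split=> //.
  exact: l2_cut.
elim: s us {es} => [_|x s IH /= /andP[xs us]].
  by rewrite (_ : cutoff _ _ = (fun=> 0)).
rewrite (_ : cutoff _ _ = fun i => delta x (f x) i + cutoff (mem s) f i).
  by apply: PD; [exact: l2_cut|exact: IH].
apply/funext => i; rewrite /cutoff /delta/= inE.
by have [->|_] := eqVneq i x; rewrite ?(negPf xs) ?addr0 ?add0r.
Qed.

Lemma geometric_small (K q e : R) : 0 <= K -> 0 <= q -> q < 1 -> 0 < e ->
  exists n, K * q ^+ n <= e.
Proof.
move=> K0 q0 q1 e0.
have : (fun n => K * q ^+ n) @ \oo --> K * 0.
  by apply: cvgMr; apply: cvg_expr; rewrite ger0_norm.
rewrite mulr0 => /cvgrPdist_le/(_ e e0)[n _ /(_ n (leqnn n))] /=.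
by rewrite sub0r normrN => H; exists n; apply: le_trans H; exact: ler_norm.
Qed.

Lemma real_nested (x r : nat -> R) : (forall n m, x n - r n <= x m + r m) ->
  exists y, forall n, `|y - x n| <= r n.
Proof.
move=> H; pose S := range (fun n => x n - r n).
have ubS m : ubound S (x m + r m) by move=> _ [n _ <-].
have S0 : S !=set0 by exists (x 0%N - r 0%N), 0%N.
exists (sup S) => n; rewrite ler_norml; apply/andP; split.
  rewrite lerBrDr addrC; apply: ub_le_sup; first by exists (x 0%N + r 0%N).
  by exists n.
by rewrite lerBlDr addrC; apply: ge_sup.
Qed.

(* Coordinatewise limits exist by nested intervals; the norm estimate then
   passes to the limit on every finite set of coordinates. *)
Lemma l2_complete (u : nat -> I -> R[i]) (K q : R) : 0 <= K -> 0 <= q -> q < 1 ->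
  (forall n, l2 (u n)) ->
  (forall n, l2norm (fun i => u n.+1 i - u n i) <= K * q ^+ n) ->
  exists2 f, l2 f & forall n, l2norm (fun i => f i - u n i) <= K / (1 - q) * q ^+ n.
Proof.
move=> K0 q0 q1 u2 uK; pose r n : R := K / (1 - q) * q ^+ n.
have q1' : 0 < 1 - q by rewrite subr_gt0.
have r0 n : 0 <= r n by rewrite mulr_ge0 ?exprn_ge0// divr_ge0// ltW.
have rS n : K * q ^+ n + r n.+1 = r n.
  by rewrite /r exprS; field; rewrite gt_eqF.
have du n k : l2norm (fun i => u (n + k)%N i - u n i) <= r n - r (n + k)%N.
  elim: k => [|k IH].
    rewrite addn0 subrr (_ : (fun i => _) = (fun=> 0)) ?l2norm0//.
    by apply/funext => i; rewrite subrr.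
  rewrite addnS; have := uK (n + k)%N; have := rS (n + k)%N => e1 e2.
  have := l2norm_triangle (l2B (u2 (n + k).+1) (u2 (n + k)%N))
    (l2B (u2 (n + k)%N) (u2 n)).
  rewrite (_ : (fun i => _) = fun i => u (n + k).+1 i - u n i); first by lra.
  by apply/funext => i; rewrite addrA subrK.
have dur n m : l2norm (fun i => u m i - u n i) <= r n + r m.
  have [nm|/ltnW mn] := leqP n m.
    have := du n (m - n)%N; rewrite subnKC// => /le_trans; apply.
    by have := r0 m; lra.
  have := du m (n - m)%N; rewrite subnKC// l2norm_subC => /le_trans; apply.
  by have := r0 n; lra.
have sq_le n m i : sqn (u m i - u n i) <= (r n + r m) ^+ 2.
  apply: le_trans (sqn_le_nsq i (l2B (u2 m) (u2 n))) _.
  by rewrite -sqr_l2norm ler_pXn2r ?nnegrE ?l2norm_ge0 ?addr_ge0.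
have coord (p : R[i] -> R) : (forall x y, p (x - y) = p x - p y) ->
    (forall x, p x ^+ 2 <= sqn x) ->
    forall i, exists y, forall n, `|y - p (u n i)| <= r n.
  move=> pB psq i; apply: real_nested => n m.
  have : `|p (u n i) - p (u m i)| <= r n + r m.
    rewrite -(@ler_pXn2r _ 2) ?nnegrE ?addr_ge0// real_normK ?num_real// -pB.
    by apply: le_trans (psq _) _; rewrite [r n + _]addrC sq_le.
  by rewrite ler_norml => /andP[_]; lra.
have [x xP] := choice (coord (@complex.Re R)
  (fun x y => ltac:(by case: x; case: y))
  (fun x => ltac:(by rewrite lerDl sqr_ge0))).
have [y yP] := choice (coord (@complex.Im R)
  (fun x y => ltac:(by case: x; case: y))
  (fun x => ltac:(by rewrite lerDr sqr_ge0))).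
pose f i := Complex (x i) (y i).
have fle n i : sqn (f i - u n i) <= 2 * r n ^+ 2.
  have := xP i n; have := yP i n; rewrite /f; case: (u n i) => a b /= h1 h2.
  rewrite /sqn/=.
  have s1 : (x i - a) ^+ 2 <= r n ^+ 2.
    by rewrite -real_normK ?num_real// ler_pXn2r ?nnegrE.
  have s2 : (y i - b) ^+ 2 <= r n ^+ 2.
    by rewrite -real_normK ?num_real// ler_pXn2r ?nnegrE.
  by lra.
have fu n : l2 (fun i => f i - u n i) /\ l2norm (fun i => f i - u n i) <= r n.
  apply: l2norm_cut_le => // s us; apply/ler_addgt0Pr => e e0.
  (* By [fle], each coordinate contributes at most [2 * r m ^+ 2], so [f - u m] has norm at most
     [c * r m] on [s]. The auxiliary index [m] makes this, plus the [r m] coming from [u m - u n],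
     at most [e]; the size of [s] does not survive in the bound. *)
  pose c : R := Num.sqrt (2 * (size s)%:R).
  have c0 : 0 <= c by exact: sqrtr_ge0.
  have [m me] : exists m, (c + 1) * (K / (1 - q)) * q ^+ m <= e.
    by apply: geometric_small => //; rewrite mulr_ge0 ?addr_ge0 ?divr_ge0// ltW.
  have cm : l2norm (cutoff (mem s) (fun i => f i - u m i)) <= c * r m.
    have crm0 : 0 <= c * r m by rewrite mulr_ge0.
    rewrite -(@ler_pXn2r _ 2) ?nnegrE ?l2norm_ge0//.
    rewrite sqr_l2norm exprMn sqr_sqrtr ?mulr_ge0//.
    rewrite /nsq l2normsq_cut_seq//=.
    apply: (@le_trans _ _ (\sum_(i <- s) 2 * r m ^+ 2)); first exact: ler_sum.
    by rewrite big_const_seq count_predT iter_addr addr0 -mulr_natr; lra.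
  have := l2norm_triangle (l2_cut_seq (fun i => f i - u m i) us)
    (l2_cut_seq (fun i => u m i - u n i) us).
  rewrite (_ : (fun i => _) = cutoff (mem s) (fun i => f i - u n i)); last first.
    apply/funext => i; rewrite /cutoff/=.
    by case: ifP => _; rewrite ?addr0// addrA subrK.
  have := l2norm_le (sqn_cut_le (mem s) (fun i => u m i - u n i))
    (l2B (u2 m) (u2 n)).
  have {}me : (c + 1) * r m <= e by rewrite /r mulrA.
  by move: (dur n m) cm me; lra.
exists f; last by move=> n; exact: (fu n).2.
rewrite (_ : f = fun i => (f i - u 0%N i) + u 0%N i).
  by apply: l2D; [exact: (fu 0%N).1|].
by apply/funext => i; rewrite subrK.
Qed.

End Cut.

(** * Approximate eigenvalues of symmetric operators *)

Section Operators.
Context {R : realType} {I : choiceType}.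
Implicit Types (f g : I -> R[i]) (V : set (I -> R[i]))
  (A S : (I -> R[i]) -> I -> R[i]) (c z : R[i]).

(** The common frame for [l2] and for both sectors, so that the spectral argument is made once.
    Closedness lets the limit of a Neumann series stay in [V]. *)
Definition closed_subspace V := [/\ V `<=` l2, V (fun=> 0),
  forall c f g, V f -> V g -> V (fun i => c * f i + g i)
  & forall f, l2 f -> (forall e : R, 0 < e ->
      exists2 g, V g & l2norm (fun i => f i - g i) <= e) -> V f].

Lemma closed_subspace_l2 : closed_subspace (@l2 R I).
Proof. by split=> //; [exact: l2_0|exact: l2_lin]. Qed.

Definition op_shift A z f : I -> R[i] := fun i => A f i - z * f i.

Definition symmetric_operator V A :=
  forall f g, V f -> V g -> rin (A f) g = rin f (A g).

Section Subspace.
Variables (V : set (I -> R[i])) (cV : closed_subspace V).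

Lemma sub_l2 f : V f -> l2 f. Proof. by case: cV => + _ _ _; apply. Qed.

Lemma sub0 : V (fun=> 0). Proof. by case: cV. Qed.

Lemma sub_lin c f g : V f -> V g -> V (fun i => c * f i + g i).
Proof. by case: cV => _ _ + _; apply. Qed.

Lemma subD f g : V f -> V g -> V (fun i => f i + g i).
Proof.
move=> Vf Vg; rewrite (_ : (fun i => _) = fun i => 1 * f i + g i).
  exact: sub_lin.
by apply/funext => i; rewrite mul1r.
Qed.

Lemma subB f g : V f -> V g -> V (fun i => f i - g i).
Proof.
move=> Vf Vg; rewrite (_ : (fun i => _) = fun i => -1 * g i + f i).
  exact: sub_lin.
by apply/funext => i; rewrite mulN1r addrC.
Qed.

Lemma subZ c f : V f -> V (fun i => c * f i).
Proof.
move=> Vf; rewrite (_ : (fun i => _) = fun i => c * f i + 0).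
  by apply: sub_lin => //; exact: sub0.
by apply/funext => i; rewrite addr0.
Qed.

Section BoundedOperator.
Variables (A : (I -> R[i]) -> I -> R[i]) (bA : bounded_operator V A).

Lemma bop_sub f : V f -> V (A f). Proof. by case: bA => + _ _; apply. Qed.

Lemma bop_lin c f g : V f -> V g ->
  A (fun i => c * f i + g i) = (fun i => c * A f i + A g i).
Proof. by case: bA => _ + _; apply. Qed.

Lemma bop_bound :
  exists2 M : R, 0 < M & forall f, V f -> l2norm (A f) <= M * l2norm f.
Proof.
case: bA => _ _ [M HM]; exists (`|M| + 1) => [|f Vf].
  by have := normr_ge0 M; lra.
apply: le_trans (HM _ Vf) _; rewrite ler_wpM2r ?l2norm_ge0//.
by have := ler_norm M; lra.
Qed.

Lemma bopB f g : V f -> V g -> A (fun i => f i - g i) = (fun i => A f i - A g i).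
Proof.
move=> Vf Vg; rewrite (_ : (fun i => _) = fun i => -1 * g i + f i).
  by rewrite bop_lin//; apply/funext => i; rewrite mulN1r addrC.
by apply/funext => i; rewrite mulN1r addrC.
Qed.

Lemma bop0 : A (fun=> 0) = (fun=> 0).
Proof.
have := bopB sub0 sub0.
rewrite (_ : (fun i : I => _ - _) = (fun=> 0)); last first.
  by apply/funext => i; rewrite subr0.
by move=> ->; apply/funext => i; rewrite subrr.
Qed.

Lemma bopZ c f : V f -> A (fun i => c * f i) = (fun i => c * A f i).
Proof.
move=> Vf; have := bop_lin c Vf sub0; rewrite bop0.
rewrite (_ : (fun i => _ + _) = fun i => c * f i); last first.
  by apply/funext => i; rewrite addr0.
by move=> ->; apply/funext => i; rewrite addr0.
Qed.

Lemma bopD f g : V f -> V g -> A (fun i => f i + g i) = (fun i => A f i + A g i).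
Proof.
move=> Vf Vg; rewrite (_ : (fun i => _) = fun i => 1 * f i + g i).
  by rewrite bop_lin//; apply/funext => i; rewrite mul1r.
by apply/funext => i; rewrite mul1r.
Qed.

Lemma bop_op_shift z : bounded_operator V (op_shift A z).
Proof.
split=> [f Vf|c f g Vf Vg|].
- by apply: subB; [exact: bop_sub|exact: subZ].
- by rewrite /op_shift bop_lin//; apply/funext => i; ring.
have [M M0 HM] := bop_bound; exists (M + Num.sqrt (sqn z)) => f Vf.
apply: le_trans (l2norm_triangleB _ _) _.
- exact/sub_l2/bop_sub.
- exact/sub_l2/subZ.
by rewrite l2normZ ?mulrDl ?lerD2r ?HM//; exact: sub_l2.
Qed.

Lemma resolvent_lower_bound z : resolvent_set V A z ->
  exists2 e : R, 0 < e & forall f, V f -> e * l2norm f <= l2norm (op_shift A z f).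
Proof.
move=> [B [bB BA _]]; case: bB => _ _ [M HM].
have M0 : 0 < `|M| + 1 by have := normr_ge0 M; lra.
exists (`|M| + 1)^-1; first by rewrite invr_gt0.
move=> f Vf; rewrite ler_pdivrMl// -[in leLHS](BA f Vf).
have Vs : V (op_shift A z f) by case: (bop_op_shift z) => + _ _; apply.
apply: le_trans (HM _ Vs) _; rewrite ler_wpM2r ?l2norm_ge0//.
by have := ler_norm M; lra.
Qed.

End BoundedOperator.

(** Neumann series: [u n] is the partial sum of the iterates of [S] on [g], and its limit solves
    [f = g + S f]. *)
Lemma contraction_surjective S (q : R) : 0 <= q -> q < 1 ->
  (forall f, V f -> V (S f)) ->
  (forall f g, V f -> V g -> S (fun i => f i - g i) = (fun i => S f i - S g i)) ->
  (forall f, V f -> l2norm (S f) <= q * l2norm f) ->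
  forall g, V g -> exists2 f, V f & (fun i => f i - S f i) = g.
Proof.
move=> q0 q1 VS SB Sq g Vg.
pose u := fix u n : I -> R[i] := if n is n.+1 then fun i => g i + S (u n) i else g.
have Vu n : V (u n) by elim: n => //= n IH; apply: subD => //; exact: VS.
have du n : l2norm (fun i => u n.+1 i - u n i) <= l2norm (S g) * q ^+ n.
  elim: n => [|n IH].
    rewrite expr0 mulr1 (_ : (fun i => _) = S g)//.
    by apply/funext => i /=; rewrite addrC addKr.
  rewrite (_ : (fun i => _) = S (fun i => u n.+1 i - u n i)).
    apply: le_trans (Sq _ _) _; first exact: subB.
    by rewrite exprS mulrCA ler_wpM2l.
  by rewrite SB//; apply/funext => i /=; rewrite opprD addrACA subrr add0r.
have [f f2 fu] := l2_complete (l2norm_ge0 (S g)) q0 q1 (fun n => sub_l2 (Vu n)) du.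
have K0 : 0 <= l2norm (S g) / (1 - q).
  by rewrite divr_ge0 ?l2norm_ge0// subr_ge0 ltW.
have Vf : V f.
  case: cV => _ _ _ cl; apply: cl => // e e0.
  have [n ne] := geometric_small K0 q0 q1 e0.
  by exists (u n) => //; apply: le_trans (fu n) ne.
exists f => //.
have VfSf : V (fun i => f i - S f i) by apply: subB => //; exact: VS.
suff nz : l2norm (fun i => (f i - S f i) - g i) = 0.
  apply/funext => i; apply/eqP; rewrite -subr_eq0; apply/eqP.
  by have := l2norm_eq0 (sub_l2 (subB VfSf Vg)) nz => /(congr1 (@^~ i)).
apply/eqP; rewrite eq_le l2norm_ge0 andbT; apply/ler_addgt0Pr => e e0.
rewrite add0r.
(* The defect of [f] equals [(f - u n.+1) - S (f - u n)]; each of the two terms is within the error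
   bound of [u n], whence the factor 2. *)
have [n ne] := geometric_small (mulr_ge0 (ler0n R 2) K0) q0 q1 e0.
rewrite (_ : (fun i => _) = fun i => (f i - u n.+1 i) - S (fun i => f i - u n i) i).
  have V1 := subB Vf (Vu n).
  apply: le_trans (l2norm_triangleB _ _) _.
  - exact/sub_l2/subB.
  - exact/sub_l2/VS.
  apply: le_trans ne; rewrite mulr2n mulrDl mul1r mulrDl; apply: lerD.
    apply: le_trans (fu n.+1) _; rewrite ler_wpM2l// exprS.
    by rewrite ler_piMl ?exprn_ge0// ltW.
  apply: le_trans (Sq _ V1) _; apply: le_trans (fu n).
  by rewrite ler_piMl ?l2norm_ge0// ltW.
by rewrite SB//; apply/funext => i /=; ring.
Qed.

Section Symmetric.
Variables (A : (I -> R[i]) -> I -> R[i]).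
Hypotheses (bA : bounded_operator V A) (sA : symmetric_operator V A).

Lemma rin_op_shift z f g : V f -> V g ->
  rin f (op_shift A z g) = rin (op_shift A z^* f) g.
Proof.
move=> Vf Vg; have [f2 g2] := (sub_l2 Vf, sub_l2 Vg).
rewrite rinBr ?rinBl//; try exact/sub_l2/subZ; try exact/sub_l2/(bop_sub bA).
by rewrite sA// (rinZ_conj z^* f g) conjCK.
Qed.

Lemma op_shiftC z w f : V f ->
  op_shift A z (op_shift A w f) = op_shift A w (op_shift A z f).
Proof.
move=> Vf; have VA := bop_sub bA Vf.
have VZ c : V (fun i => c * f i) by exact: subZ.
by rewrite {1 3}/op_shift !bopB// !bopZ//; apply/funext => i; rewrite /op_shift; ring.
Qed.

(** Normality of [A - z]: its adjoint is [A - z^*], and the two commute. Hence a bound on [A - z]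
    also bounds its adjoint. *)
Lemma nsq_op_shift_conj z f : V f -> nsq (op_shift A z^* f) = nsq (op_shift A z f).
Proof.
move=> Vf; rewrite -!rinff.
have Vs w : V (op_shift A w f) by case: (bop_op_shift bA w) => + _ _; apply.
rewrite -(rin_op_shift z Vf (Vs z^*)) op_shiftC//.
by rewrite (rin_op_shift z^* Vf (Vs z)) conjCK.
Qed.

(* Bounded below, [D = A - z] satisfies [D^* D >= e^2], so [1 - c D^* D] is a
   contraction for small [c > 0] and [D^* D = D D^*] is onto by Neumann series. *)
Lemma bounded_below_resolvent z (e : R) : 0 < e ->
  (forall f, V f -> e * l2norm f <= l2norm (op_shift A z f)) -> resolvent_set V A z.
Proof.
move=> e0 below.
have bD w := bop_op_shift bA w.
have VD w f : V f -> V (op_shift A w f) by move=> Vf; exact: (bop_sub (bD w) Vf).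
have [M0 M0p HM0] := bop_bound (bD z); pose K := M0 + e.
have K0 : 0 < K by rewrite addr_gt0.
have HK f : V f -> nsq (op_shift A z f) <= K ^+ 2 * nsq f.
  move=> Vf; have h := mulr_ge0 (ltW K0) (l2norm_ge0 f).
  rewrite -!sqr_l2norm -exprMn ler_pXn2r ?nnegrE ?l2norm_ge0//.
  by apply: le_trans (HM0 _ Vf) _; rewrite ler_wpM2r ?l2norm_ge0// lerDl ltW.
have HK' f : V f -> nsq (op_shift A z^* f) <= K ^+ 2 * nsq f.
  by move=> Vf; rewrite nsq_op_shift_conj// HK.
have low f : V f -> e ^+ 2 * nsq f <= nsq (op_shift A z f).
  move=> Vf; have h := mulr_ge0 (ltW e0) (l2norm_ge0 f).
  rewrite -!sqr_l2norm -exprMn ler_pXn2r ?nnegrE ?l2norm_ge0//.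
  exact: below.
pose T f := op_shift A z^* (op_shift A z f).
(* This [c] minimizes [1 - 2 * c * e ^+ 2 + c ^+ 2 * K ^+ 4], the bound on the squared norm of [S];
   the minimum is [q2] below. Adding [e] to [M0] in [K] ensures [e <= K], hence [0 <= q2]. *)
pose c : R := e ^+ 2 / K ^+ 4.
have c0 : 0 < c by rewrite divr_gt0 ?exprn_gt0.
pose S f : I -> R[i] := fun i => f i - c%:C%C * T f i.
have VT f : V f -> V (T f) by move=> Vf; apply/VD/VD.
have VS f : V f -> V (S f) by move=> Vf; apply: subB => //; apply: subZ; exact: VT.
pose q2 : R := 1 - e ^+ 4 / K ^+ 4.
have q20 : 0 <= q2.
  rewrite subr_ge0 ler_pdivrMr ?exprn_gt0// mul1r ler_pXn2r ?nnegrE ?ltW//.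
  by rewrite ltrDr.
have q21 : q2 < 1 by rewrite gtrBl divr_gt0// exprn_gt0.
have nS f : V f -> nsq (S f) <= q2 * nsq f.
  move=> Vf; have [f2 Tf2] := (sub_l2 Vf, sub_l2 (VT f Vf)).
  have -> : nsq (S f) = nsq f - 2 * c * nsq (op_shift A z f) + c ^+ 2 * nsq (T f).
    rewrite (_ : S f = fun i => f i + (- c)%:C%C * T f i); last first.
      by apply/funext => i; rewrite rmorphN mulNr.
    rewrite nsqD//; last exact: l2Z.
    rewrite rinZr// nsqZ// sqnC sqrrN /T.
    rewrite (rin_op_shift z^* Vf (VD z _ Vf)) conjCK rinff.
    by ring.
  have h1 : nsq (T f) <= K ^+ 4 * nsq f.
    apply: le_trans (HK' _ (VD _ _ Vf)) _.
    rewrite (_ : K ^+ 4 * _ = K ^+ 2 * (K ^+ 2 * nsq f)); last by ring.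
    by rewrite ler_wpM2l ?HK// exprn_ge0// ltW.
  have h2 := low _ Vf.
  have -> : q2 * nsq f = nsq f - 2 * c * (e ^+ 2 * nsq f) + c ^+ 2 * (K ^+ 4 * nsq f).
    by rewrite /q2 /c; field; rewrite gt_eqF.
  apply: lerD; last by rewrite ler_wpM2l// sqr_ge0.
  by rewrite lerD2l lerN2 ler_wpM2l// mulr_ge0// ltW.
have surjT g : V g -> exists2 f, V f & T f = g.
  move=> Vg; have Vcg : V (fun i => c%:C%C * g i) by exact: subZ.
  have q1 : Num.sqrt q2 < 1.
    by rewrite -sqrtr1 ltr_sqrt.
  have [|f Vf|f Vf fS] := contraction_surjective (sqrtr_ge0 q2) q1 VS _ _ Vcg.
  - move=> f h Vf Vh.
    rewrite /S /T (bopB (bD z))// (bopB (bD z^*)); try exact: VD.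
    by apply/funext => i; ring.
  - rewrite /l2norm -/(nsq _) -/(nsq _).
    by rewrite -sqrtrM// ler_wsqrtr// nS.
  exists f => //; apply/funext => i; have := congr1 (@^~ i) fS => /=.
  rewrite /S opprB addrC subrK => /mulfI; apply.
  by rewrite eq_complex/= gt_eqF.
have surjD g : V g -> exists f, V f /\ op_shift A z f = g.
  move=> Vg; have [f Vf Tf] := surjT g Vg; exists (op_shift A z^* f); split.
    exact: VD.
  by rewrite op_shiftC.
have injD f g : V f -> V g -> op_shift A z f = op_shift A z g -> f = g.
  move=> Vf Vg fg; have V1 := subB Vf Vg.
  have := below _ V1; rewrite (bopB (bD z))// fg.
  rewrite (_ : (fun i => op_shift _ _ _ _ - _) = (fun=> 0)); last first.
    by apply/funext => i; rewrite subrr.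
  rewrite l2norm0 pmulr_rle0// => le0.
  have /(congr1 (@^~ _)) h : (fun i => f i - g i) = (fun=> 0).
    by apply: l2norm_eq0; [exact: sub_l2|apply/eqP; rewrite eq_le le0 l2norm_ge0].
  by apply/funext => i; apply/eqP; rewrite -subr_eq0; apply/eqP; exact: (h i).
pose B g := xget (fun=> 0) [set f | V f /\ op_shift A z f = g].
have BP g : V g -> V (B g) /\ op_shift A z (B g) = g.
  by move=> Vg; have [f fP] := surjD g Vg;
    apply: (@xgetPex _ _ [set k | V k /\ op_shift A z k = g]); exists f.
exists B; split; [split| |].
- by move=> f /BP[].
- move=> d f g Vf Vg; have [VBf Bf] := BP f Vf; have [VBg Bg] := BP g Vg.
  have [Vl Bl] := BP _ (sub_lin d Vf Vg).
  apply: injD => //; first exact: sub_lin.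
  by rewrite Bl (bop_lin (bD z))// Bf Bg.
- exists e^-1 => f Vf; have [VBf Bf] := BP f Vf.
  by rewrite ler_pdivlMl// -[in leRHS]Bf below.
- move=> f Vf; have [VBf Bf] := BP _ (VD z f Vf); exact: injD.
by move=> f Vf; have [_] := BP f Vf.
Qed.

Lemma spectrum_approx z : spectrum V A z -> forall e : R, 0 < e ->
  exists f, [/\ V f, 0 < l2norm f & l2norm (op_shift A z f) <= e * l2norm f].
Proof.
move=> sz e e0; apply: contrapT => H; apply: sz.
apply: (bounded_below_resolvent e0) => f Vf; rewrite leNgt; apply/negP => lt.
apply: H; exists f; split=> //; last exact: ltW.
rewrite lt_def l2norm_ge0 andbT; apply/eqP => f0.
move: lt; rewrite f0 mulr0.
by rewrite ltNge l2norm_ge0.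
Qed.

End Symmetric.

Lemma approx_spectrum A z : bounded_operator V A ->
  (forall e : R, 0 < e ->
    exists f, [/\ V f, 0 < l2norm f & l2norm (op_shift A z f) <= e * l2norm f]) ->
  spectrum V A z.
Proof.
move=> bA H /(resolvent_lower_bound bA)[e e0 le_e].
have [f [Vf f0 fe]] := H (e / 2) ltac:(by rewrite divr_gt0).
have := le_trans (le_e f Vf) fe; rewrite ler_pM2r//.
by lra.
Qed.

End Subspace.

End Operators.

(** * Reindexing, symmetry from matrix entries, multiplication operators *)

Section MoreOperators.
Context {R : realType}.

Lemma l2normsq_comp_inj (I J : choiceType) (p : I -> J) (f : J -> R[i]) :
  injective p -> (l2normsq (f \o p) <= l2normsq f)%E.
Proof.
move=> pI; rewrite !l2normsqE; apply: tsum_fsetP => s us.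
have := @tsum_seq R J (fun i => sqn (f i)) (map p s) (fun _ => sqn_ge0 _).
by rewrite map_inj_uniq// big_map => /(_ us).
Qed.

Lemma l2_comp_inj (I J : choiceType) (p : I -> J) (f : J -> R[i]) :
  injective p -> l2 f -> l2 (f \o p).
Proof. by move=> pI; apply: le_lt_trans; exact: l2normsq_comp_inj. Qed.

Lemma l2norm_comp_bij (I J : choiceType) (p : I -> J) (f : J -> R[i]) :
  bijective p -> l2norm (f \o p) = l2norm f.
Proof.
move=> pB; rewrite /l2norm; congr (Num.sqrt (fine _)).
have [q pK qK] := pB; apply/eqP; rewrite eq_le l2normsq_comp_inj; last exact: bij_inj.
have -> : l2normsq f = l2normsq ((f \o p) \o q).
  by congr l2normsq; apply/funext => i /=; rewrite qK.
by apply: l2normsq_comp_inj; exact: can_inj qK.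
Qed.

Section Fixed.
Context {I : choiceType}.
Implicit Types (f g : I -> R[i]) (A B : (I -> R[i]) -> I -> R[i]).

(* Both sides of the symmetry relation are continuous in each argument, so it is
   enough to compare matrix entries. *)
Lemma symmetric_delta A : bounded_operator l2 A ->
  (forall x y c d, rdot (A (delta x c) y) d = rdot c (A (delta y d) x)) ->
  symmetric_operator l2 A.
Proof.
move=> bA Asym.
have cl := @closed_subspace_l2 R I.
have A2 f : l2 f -> l2 (A f) by exact: bop_sub bA _.
have [M M0 HM] := bop_bound bA.
have one_sided g : l2 g ->
    (forall x c, rin (A (delta x c)) g = rin (delta x c) (A g)) ->
    forall f, l2 f -> rin (A f) g = rin f (A g).
  move=> g2 gD; apply: l2_ind.
  - by rewrite (bop0 cl bA) !(rinC (fun=> 0)) !rin0r.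
  - move=> f x c f2 IH; have d2 := l2_delta x c.
    have [Ad2 Af2] := (A2 _ d2, A2 _ f2).
    by rewrite (bopD bA)// !rinDl ?gD ?IH//; exact: A2.
  move=> f f2 H; apply/eqP; rewrite -subr_eq0 -normr_le0.
  apply/ler_addgt0Pr => e e0; rewrite add0r.
  have K0 : 0 < 2 * M * l2norm g + 1.
    by have := mulr_ge0 (ltW M0) (l2norm_ge0 g); lra.
  have [k [k2 Pk ke]] := H (e / (2 * M * l2norm g + 1)) ltac:(by rewrite divr_gt0).
  have fk2 := l2B f2 k2.
  have -> : rin (A f) g - rin f (A g) =
            rin (A (fun i => f i - k i)) g - rin (fun i => f i - k i) (A g).
    rewrite (bopB bA)// !rinBl//; try exact: A2.
    by rewrite Pk; ring.
  have h1 := rin_le (A2 _ fk2) g2; have h2 := rin_le fk2 (A2 _ g2).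
  have h3 := HM _ fk2; have h4 := HM _ g2.
  move: ke; rewrite ler_pdivlMr// => ke; apply: le_trans ke.
  apply: le_trans (ler_normB _ _) _.
  have h5 := ler_wpM2r (l2norm_ge0 g) h3.
  have h6 := ler_wpM2l (l2norm_ge0 (fun i => f i - k i)) h4.
  have := l2norm_ge0 (fun i => f i - k i).
  move: (l2norm _) (l2norm _) (l2norm _) (l2norm _) h1 h2 h3 h4 h5 h6 => *; lra.
(* Two passes: the first reduces the left argument to a point mass, the second, after exchanging the
   sides, does so for the right one. *)
move=> f g f2 g2; apply: (one_sided g g2 _ f f2) => x c.
rewrite (rinC (A _)) (rinC (delta x c)); symmetry.
apply: (one_sided (delta x c) _ _ g g2); first exact: l2_delta.
by move=> y d; rewrite rin_delta rinC rin_delta Asym rdotC.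
Qed.

Definition bounded_symmetric (V : set (I -> R[i])) A :=
  bounded_operator V A /\ symmetric_operator V A.

Lemma bounded_symmetric0 : bounded_symmetric l2 (fun _ _ => 0).
Proof.
split; first split.
- by move=> *; exact: l2_0.
- by move=> c f g _ _; apply/funext => i; rewrite mulr0 addr0.
- by exists 0 => f _; rewrite l2norm0 mul0r.
by move=> f g _ _; rewrite rinC !rin0r.
Qed.

Lemma bounded_symmetricD A B : bounded_symmetric l2 A -> bounded_symmetric l2 B ->
  bounded_symmetric l2 (fun f i => A f i + B f i).
Proof.
move=> [bA sA] [bB sB]; have cl := @closed_subspace_l2 R I.
have A2 f : l2 f -> l2 (A f) by exact: bop_sub bA _.
have B2 f : l2 f -> l2 (B f) by exact: bop_sub bB _.
split; first split.
- by move=> f f2; apply: l2D; [exact: A2|exact: B2].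
- move=> c f g f2 g2; rewrite (bop_lin bA)// (bop_lin bB)//.
  by apply/funext => i; ring.
- have [M M0 HM] := bop_bound bA; have [M' M0' HM'] := bop_bound bB.
  exists (M + M') => f f2; apply: le_trans (l2norm_triangle (A2 _ f2) (B2 _ f2)) _.
  by rewrite mulrDl; apply: lerD; [exact: HM|exact: HM'].
move=> f g f2 g2; have [Af2 Ag2] := (A2 _ f2, A2 _ g2).
have [Bf2 Bg2] := (B2 _ f2, B2 _ g2).
by rewrite rinDl// rinDr// sA// sB.
Qed.

Lemma bounded_symmetric_sum (K : Type) (r : seq K) (P : pred K)
    (A : K -> (I -> R[i]) -> I -> R[i]) :
  (forall k, bounded_symmetric l2 (A k)) ->
  bounded_symmetric l2 (fun f i => \sum_(k <- r | P k) A k f i).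
Proof.
move=> bA; elim: r => [|k r IH].
  rewrite (_ : (fun _ _ => _) = fun _ _ => 0); first exact: bounded_symmetric0.
  by apply/funext => f; apply/funext => i; rewrite big_nil.
have [Pk|Pk] := boolP (P k).
  rewrite (_ : (fun _ _ => _) = fun f i => A k f i + \sum_(k <- r | P k) A k f i).
    exact: bounded_symmetricD.
  by apply/funext => f; apply/funext => i; rewrite big_cons Pk.
rewrite (_ : (fun _ _ => _) = fun f i => \sum_(k <- r | P k) A k f i)//.
by apply/funext => f; apply/funext => i; rewrite big_cons (negPf Pk).
Qed.

(** The bound on [q] is asked only on the support of [f], because the energy between two clusters is
    small only where the clusters are far apart. *)
Lemma l2norm_mul_le (q : I -> R) (M : R) f : l2 f -> 0 <= M ->
  (forall i, f i != 0 -> `|q i| <= M) ->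
  l2 (fun i => (q i)%:C%C * f i) /\
  l2norm (fun i => (q i)%:C%C * f i) <= M * l2norm f.
Proof.
move=> f2 M0 qM.
have le_ i : sqn ((q i)%:C%C * f i) <= sqn (M%:C%C * f i).
  have [->|fi] := eqVneq (f i) 0; first by rewrite !mulr0.
  rewrite !sqnM !sqnC ler_wpM2r ?sqn_ge0//.
  by rewrite -real_normK ?num_real// ler_pXn2r ?nnegrE ?qM.
split; first by apply: l2_le le_ _; exact: l2Z.
apply: le_trans (l2norm_le le_ _) _; first exact: l2Z.
by rewrite l2normZ// sqnC sqrtr_sqr ger0_norm.
Qed.

Lemma bounded_symmetric_mul (q : I -> R) (M : R) : (forall i, `|q i| <= M) ->
  bounded_symmetric l2 (fun f i => (q i)%:C%C * f i).
Proof.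
move=> qM; have q' f : l2 f -> l2 (fun i => (q i)%:C%C * f i) /\
    l2norm (fun i => (q i)%:C%C * f i) <= `|M| * l2norm f.
  by move=> f2; apply: l2norm_mul_le => // i _; exact: le_trans (qM i) (ler_norm _).
split; first split.
- by move=> f /q'[].
- by move=> c f g _ _; apply/funext => i; ring.
- by exists `|M| => f /q'[].
move=> f g _ _; congr rsum; apply/funext => i.
by case: (f i) (g i) => a b [c d]; rewrite /rdot/=; ring.
Qed.

End Fixed.

(** * The Hamiltonian on the symmetric and antisymmetric sectors *)

Section Hamiltonian.
Variables (h : (int -> R[i]) -> int -> R[i]) (Q : nat -> R).
Hypotheses (h_bounded : bounded_operator l2 h) (h_selfadj : self_adjoint h).
Variable (QM : R).
Hypothesis Q_bounded : forall r, `|Q r| <= QM.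

Lemma h_delta_sym (x y : int) c d :
  rdot (h (delta x c) y) d = rdot c (h (delta y d) x).
Proof.
rewrite -rin_delta -rin_re h_selfadj; try exact: l2_delta.
by rewrite rin_re rinC rin_delta rdotC.
Qed.

Lemma update_inj N (z : config N) i : injective (update z i).
Proof. by move=> x y /ffunP/(_ i); rewrite !ffunE eqxx. Qed.

Lemma update_update N (z : config N) i x y : update (update z i x) i y = update z i y.
Proof. by apply/ffunP => k; rewrite !ffunE; case: eqP. Qed.

Lemma update_self N (z : config N) i : update z i (z i) = z.
Proof. by apply/ffunP => k; rewrite !ffunE; case: eqP => [->|]. Qed.

Lemma update_at N (z : config N) i y : update z i y i = y.
Proof. by rewrite ffunE eqxx. Qed.

Lemma l2_slice N (f : config N -> R[i]) z i : l2 f -> l2 (fun y => f (update z i y)).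
Proof. exact/l2_comp_inj/update_inj. Qed.

(** Tonelli along the lines in direction [i]; each line is represented by its point whose [i]-th
    coordinate is 0. The bound of [h] on every line then sums to the same bound for
    [one_body h i]. *)
Lemma tsum_slices N (i : 'I_N) (F : config N -> R) : (forall z, 0 <= F z) ->
  tsum F = (\esum_(w in [set w : config N | w i = (0 : int)%R])
    tsum (fun y => F (update w i y)))%E.
Proof.
move=> F0; rewrite /tsum esum_esum; last by move=> *; rewrite lee_fin.
apply: (@reindex_esum _ _ _ _ setT
  (fun k : config N * int => update k.1 i k.2)); split.
- by [].
- move=> [w x] [w' x']; rewrite !inE/= => -[w0 _] [w0' _] e.
  have -> : x = x'.
    by have := congr1 (fun z : config N => z i) e; rewrite /= !update_at.
  congr pair; have := congr1 (fun z => update z i 0) e.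
  by rewrite !update_update -{1}w0 -{1}w0' !update_self.
move=> z _; exists (update z i 0, z i) => /=.
  by split=> //; rewrite update_at.
by rewrite update_update update_self.
Qed.

Lemma bounded_one_body N (i : 'I_N) : bounded_operator l2 (one_body h i).
Proof.
have [M M0 HM] := bop_bound h_bounded.
have le_ f : l2 f -> (l2normsq (one_body h i f) <= (M ^+ 2)%:E * l2normsq f)%E.
  move=> f2; rewrite !l2normsqE -tsumZ ?sqr_ge0//; last by move=> j; exact: sqn_ge0.
  rewrite (tsum_slices i); last by move=> j; exact: sqn_ge0.
  rewrite [leRHS](tsum_slices i); last first.
    by move=> j; rewrite mulr_ge0 ?sqr_ge0 ?sqn_ge0.
  apply: le_esum => w _; have s2 := l2_slice w i f2.
  rewrite tsumZ ?sqr_ge0//; last by move=> j; exact: sqn_ge0.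
  rewrite -(l2normsqE (fun y => f (update w i y))) l2_nsq// -EFinM.
  rewrite (_ : (fun y => _) = fun y => sqn (h (fun y => f (update w i y)) y)).
    rewrite -l2normsqE l2_nsq; last exact: (bop_sub h_bounded).
    have := HM _ s2 => hs.
    rewrite lee_fin -!sqr_l2norm -exprMn ler_pXn2r ?nnegrE ?l2norm_ge0//.
    by rewrite mulr_ge0 ?l2norm_ge0// ltW.
  apply/funext => y; rewrite /one_body update_at; congr (sqn (h _ _)).
  by apply/funext => t; rewrite update_update.
split.
- by move=> f f2; apply: le_lt_trans (le_ _ f2) _; rewrite l2_nsq// -EFinM ltry.
- move=> c f g f2 g2; apply/funext => z; rewrite /one_body.
  by have := congr1 (@^~ (z i))
    (bop_lin h_bounded c (l2_slice z i f2) (l2_slice z i g2)).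
exists M => f f2; have := le_ _ f2.
have A2 : l2 (one_body h i f).
  by apply: le_lt_trans (le_ _ f2) _; rewrite l2_nsq// -EFinM ltry.
rewrite !l2_nsq// -EFinM lee_fin -!sqr_l2norm -exprMn ler_pXn2r ?nnegrE ?l2norm_ge0//.
by rewrite mulr_ge0 ?l2norm_ge0// ltW.
Qed.

(** The test says that [x] and [y] agree off [i]. It is symmetric in [x] and [y], so
    [symmetric_delta] reduces symmetry of [one_body h i] to the matrix entries of [h]. *)
Lemma one_body_delta N (i : 'I_N) (x y : config N) c :
  one_body h i (delta x c) y =
  if update y i (x i) == x then h (delta (x i) c) (y i) else 0.
Proof.
rewrite /one_body; case: eqP => [<-|ne].
  congr h; apply/funext => t; rewrite /delta update_at.
  have [->|nt] := eqVneq t (x i); first by rewrite eqxx.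
  by rewrite (inj_eq (@update_inj _ y i)) (negPf nt).
rewrite (_ : (fun t => _) = (fun=> 0)).
  by rewrite (bop0 (@closed_subspace_l2 R int) h_bounded).
apply/funext => t; rewrite /delta; case: eqP => // e.
by case: ne; rewrite -e update_at.
Qed.

Lemma symmetric_one_body N (i : 'I_N) : symmetric_operator l2 (one_body h i).
Proof.
apply: symmetric_delta => [|x y c d]; first exact: bounded_one_body.
rewrite !one_body_delta.
have -> : (update y i (x i) == x) = (update x i (y i) == y).
  by apply/eqP/eqP => e; rewrite -[in LHS]e update_update update_self.
case: ifP => _; last by rewrite /rdot !mul0r !mulr0.
exact: h_delta_sym.
Qed.

Lemma bounded_symmetric_hamiltonian N : bounded_symmetric l2 (hamiltonian h Q N).
Proof.
apply: bounded_symmetricD; apply: bounded_symmetric_sum => i.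
  by split; [exact: bounded_one_body|exact: symmetric_one_body].
apply: bounded_symmetric_sum => j.
exact: (bounded_symmetric_mul (q := fun z : config N => Q `|z i - z j|%N)).
Qed.

Definition pair_energy N (z : config N) : R :=
  \sum_(i < N) \sum_(j < N | (i < j)%N) Q `|z i - z j|%N.

Lemma hamiltonianE N (f : config N -> R[i]) z :
  hamiltonian h Q N f z = \sum_(i < N) one_body h i f z + (pair_energy z)%:C%C * f z.
Proof.
congr +%R; rewrite /pair_energy rmorph_sum mulr_suml; apply: eq_bigr => i _.
by rewrite rmorph_sum mulr_suml.
Qed.

Lemma permute_update N (s : 'S_N) (z : config N) i y :
  permute s (update z i y) = update (permute s z) ((s^-1)%g i) y.
Proof.
by apply/ffunP => k; rewrite !ffunE (canF_eq (permK s)).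
Qed.

(** Permutations do not respect the condition [i < j]. Doubling turns it into [i != j], which they
    do respect, and invariance becomes a reindexing. *)
Lemma pair_energyE N (z : config N) :
  pair_energy z *+ 2 = \sum_(i < N) \sum_(j < N | i != j) Q `|z i - z j|%N.
Proof.
rewrite mulr2n {2}/pair_energy (exchange_big_dep predT)//= -big_split/=.
apply: eq_bigr => i _; rewrite [RHS](bigID (fun j : 'I_N => (i < j)%N))/=.
congr +%R.
  by apply: eq_bigl => j; rewrite -val_eqE; case: ltngtP.
apply: eq_big => [j|j _]; first by rewrite -val_eqE; case: ltngtP.
by rewrite distnC.
Qed.

Lemma pair_energy_permute N (s : 'S_N) (z : config N) :
  pair_energy (permute s z) = pair_energy z.
Proof.
suff : pair_energy (permute s z) *+ 2 = pair_energy z *+ 2.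
  by rewrite !mulr2n; lra.
rewrite !pair_energyE [RHS](reindex_inj (@perm_inj _ s)); apply: eq_bigr => i _.
rewrite [RHS](reindex_inj (@perm_inj _ s)); apply: eq_big => [j|j _].
  by rewrite (inj_eq perm_inj).
by rewrite !ffunE.
Qed.

Lemma hamiltonian_permute N (s : 'S_N) (f : config N -> R[i]) z :
  hamiltonian h Q N (f \o permute s) z = hamiltonian h Q N f (permute s z).
Proof.
rewrite !hamiltonianE pair_energy_permute; congr +%R.
rewrite [RHS](reindex_inj (@perm_inj _ (s^-1)%g)); apply: eq_bigr => i _.
rewrite /one_body !ffunE permKV; congr h; apply/funext => y /=.
by rewrite permute_update.
Qed.

Lemma permute_bij N (s : 'S_N) : bijective (permute s).
Proof.
by exists (permute (s^-1)%g) => z; apply/ffunP => i; rewrite !ffunE ?permK ?permKV.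
Qed.

Lemma permuteM N (s t : 'S_N) (z : config N) :
  permute s (permute t z) = permute (s * t)%g z.
Proof. by apply/ffunP => i; rewrite !ffunE permM. Qed.

(* [e = false]: the symmetric subspace; [e = true]: the antisymmetric one. *)
Definition l2_sector (e : bool) N : set (config N -> R[i]) :=
  [set f | l2 f /\ forall (s : 'S_N) (z : config N),
    f (permute s z) = (-1) ^+ (e && s) * f z].

Arguments l2_sector e N _ : clear implicits.

Lemma l2sE N : l2s N = l2_sector false N.
Proof.
by apply/seteqP; split=> f [f2 fs]; split=> // s z; rewrite fs mul1r.
Qed.

Lemma l2aE N : l2a N = l2_sector true N.
Proof. by []. Qed.

Lemma sqn_sign (b : bool) (x : R[i]) : sqn ((-1) ^+ b * x) = sqn x.
Proof. by case: b; rewrite ?mulN1r ?mul1r ?sqnN. Qed.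

Lemma closed_subspace_sector e N : closed_subspace (l2_sector e N).
Proof.
split.
- by move=> f [].
- by split=> [|s z]; [exact: l2_0|rewrite mulr0].
- move=> c f g [f2 fs] [g2 gs]; split; first exact: l2_lin.
  by move=> s z; rewrite fs gs mulrDr mulrCA.
move=> f f2 H; split=> // s z; apply/eqP; rewrite -subr_eq0 -sqn_eq0.
rewrite eq_le sqn_ge0 andbT; apply/ler_addgt0Pr => d d0; rewrite add0r.
(* Point evaluations are continuous. The defect of [f] is a sum of two terms with squared modulus at
   most [d / 4], and [sqnD_le] doubles their sum. *)
have [g [g2 gs] gd] := H (Num.sqrt (d / 4)) ltac:(by rewrite sqrtr_gt0 divr_gt0).
have nd : nsq (fun i => f i - g i) <= d / 4.
  have d40 : 0 <= d / 4 by rewrite divr_ge0// ltW.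
  rewrite -sqr_l2norm -[leRHS]sqr_sqrtr//.
  by rewrite ler_pXn2r ?nnegrE ?l2norm_ge0 ?sqrtr_ge0.
have fg2 := l2B f2 g2.
rewrite (_ : f (permute s z) - _ = (f (permute s z) - g (permute s z)) -
    (-1) ^+ (e && s) * (f z - g z)); last first.
  by rewrite gs mulrBr opprB addrA subrK.
apply: le_trans (sqnD_le _ _) _; rewrite sqnN sqn_sign.
have := sqn_le_nsq (permute s z) fg2; have := sqn_le_nsq z fg2.
by rewrite /=; lra.
Qed.

Lemma hamiltonian_sector e N :
  bounded_operator (l2_sector e N) (hamiltonian h Q N) /\
  symmetric_operator (l2_sector e N) (hamiltonian h Q N).
Proof.
have [bH sH] := bounded_symmetric_hamiltonian N.
split; last by move=> f g [f2 _] [g2 _]; exact: sH.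
split; [|by move=> c f g [f2 _] [g2 _]; exact: bop_lin bH _ _ _ _ _|]; last first.
  by have [M _ HM] := bop_bound bH; exists M => f [f2 _]; exact: HM.
move=> f [f2 fs]; split; first exact: (bop_sub bH).
move=> s z; rewrite -hamiltonian_permute.
rewrite (_ : f \o permute s = fun z => (-1) ^+ (e && s) * f z).
  by rewrite (bopZ (@closed_subspace_l2 R _) bH).
by apply/funext => w /=; rewrite fs.
Qed.

End Hamiltonian.
End MoreOperators.
Arguments l2_sector {R} e N _.

(** * Tensor products of cluster states *)

Section Tensor.
Context {R : realType}.
Variables m n : nat.

Definition lpart (z : config (m + n)) : config m := [ffun i => z (lshift n i)].
Definition rpart (z : config (m + n)) : config n := [ffun j => z (rshift m j)].

Definition join_config (w : config m) (v : config n) : config (m + n) :=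
  [ffun k => match fintype.split k with inl i => w i | inr j => v j end].

Lemma lpart_join w v : lpart (join_config w v) = w.
Proof. by apply/ffunP => i; rewrite !ffunE (unsplitK (inl i)). Qed.

Lemma rpart_join w v : rpart (join_config w v) = v.
Proof. by apply/ffunP => i; rewrite !ffunE (unsplitK (inr i)). Qed.

Lemma join_parts z : join_config (lpart z) (rpart z) = z.
Proof.
apply/ffunP => k; rewrite !ffunE -{2}(splitK k).
by case: (fintype.split k) => i; rewrite ffunE.
Qed.

Definition tensor (f : config m -> R[i]) (g : config n -> R[i]) :
  config (m + n) -> R[i] := fun z => f (lpart z) * g (rpart z).

Lemma tsum_join (F : config (m + n) -> R) : (forall z, 0 <= F z) ->
  tsum F = (\esum_(w in [set: config m]) tsum (fun v => F (join_config w v)))%E.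
Proof.
move=> F0; rewrite /tsum esum_esum; last by move=> *; rewrite lee_fin.
apply: (@reindex_esum _ _ _ _ setT
  (fun k : config m * config n => join_config k.1 k.2)); split.
- by [].
- move=> [w v] [w' v'] _ _ /= e; congr pair.
    by rewrite -(lpart_join w v) e lpart_join.
  by rewrite -(rpart_join w v) e rpart_join.
by move=> z _; exists (lpart z, rpart z) => //=; rewrite join_parts.
Qed.

Lemma l2normsq_tensor f g : l2 f -> l2 g ->
  l2normsq (tensor f g) = (nsq f * nsq g)%:E.
Proof.
move=> f2 g2; rewrite l2normsqE tsum_join; last by move=> z; exact: sqn_ge0.
rewrite (_ : (fun w => _) = fun w => (nsq g * sqn (f w))%:E).
  rewrite -/(tsum (fun w => nsq g * sqn (f w))) tsumZ ?nsq_ge0//.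
    by rewrite -l2normsqE l2_nsq// -EFinM mulrC.
  by move=> w; exact: sqn_ge0.
apply/funext => w.
rewrite (_ : (fun v => _) = fun v => sqn (f w) * sqn (g v)).
  rewrite tsumZ ?sqn_ge0//; last by move=> v; exact: sqn_ge0.
  by rewrite -l2normsqE l2_nsq// -EFinM mulrC.
by apply/funext => v; rewrite /tensor lpart_join rpart_join sqnM.
Qed.

Lemma l2_tensor f g : l2 f -> l2 g -> l2 (tensor f g).
Proof. by move=> f2 g2; rewrite /l2/= l2normsq_tensor// ltry. Qed.

Lemma l2norm_tensor f g : l2 f -> l2 g ->
  l2norm (tensor f g) = l2norm f * l2norm g.
Proof.
by move=> f2 g2; rewrite /l2norm l2normsq_tensor//= sqrtrM ?nsq_ge0.
Qed.

Lemma lpart_lupdate z i y :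
  lpart (update z (lshift n i) y) = update (lpart z) i y.
Proof.
by apply/ffunP => k; rewrite !ffunE (inj_eq (@lshift_inj _ _)).
Qed.

Lemma rpart_lupdate z i y : rpart (update z (lshift n i) y) = rpart z.
Proof. by apply/ffunP => k; rewrite !ffunE eq_rlshift. Qed.

Lemma rpart_rupdate z j y :
  rpart (update z (rshift m j) y) = update (rpart z) j y.
Proof.
by apply/ffunP => k; rewrite !ffunE (inj_eq (@rshift_inj _ _)).
Qed.

Lemma lpart_rupdate z j y : lpart (update z (rshift m j) y) = lpart z.
Proof. by apply/ffunP => k; rewrite !ffunE eq_lrshift. Qed.

Definition cross_energy (Q : nat -> R) (z : config (m + n)) : R :=
  \sum_(i < m) \sum_(j < n) Q `|z (lshift n i) - z (rshift m j)|%N.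

Lemma pair_energy_split Q z :
  pair_energy Q z = pair_energy Q (lpart z) + pair_energy Q (rpart z) +
                    cross_energy Q z.
Proof.
rewrite /pair_energy big_split_ord/= addrAC; congr +%R; last first.
  apply: eq_bigr => i _; rewrite big_mkcond big_split_ord/= big1 ?add0r.
    rewrite [RHS]big_mkcond; apply: eq_bigr => j _.
    by rewrite ltn_add2l !ffunE.
  move=> j _; rewrite ifF//; apply/negbTE; rewrite -leqNgt.
  by rewrite ltnW// ltn_addr.
rewrite -big_split/=; apply: eq_bigr => i _.
rewrite big_mkcond big_split_ord/=; congr +%R.
  by rewrite [RHS]big_mkcond; apply: eq_bigr => j _; rewrite !ffunE.
by apply: eq_bigr => j _; rewrite ltn_addr.
Qed.

Section HamiltonianTensor.
Variables (h : (int -> R[i]) -> int -> R[i]) (Q : nat -> R).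
Hypotheses (h_bounded : bounded_operator l2 h).

(** Along a slice in one cluster the factor of the other cluster is a constant, which linearity of
    [h] pulls out. Only the cross energy fails to act on a single factor. *)
Lemma hamiltonian_tensor f g z : l2 f -> l2 g ->
  hamiltonian h Q (m + n) (tensor f g) z =
  tensor (hamiltonian h Q m f) g z + tensor f (hamiltonian h Q n g) z +
  (cross_energy Q z)%:C%C * tensor f g z.
Proof.
move=> f2 g2; have cl := @closed_subspace_l2 R int.
rewrite /tensor !hamiltonianE pair_energy_split !rmorphD/=.
rewrite big_split_ord/=.
have -> : \sum_(i < m) one_body h (lshift n i)
    (fun z => f (lpart z) * g (rpart z)) z =
    (\sum_(i < m) one_body h i f (lpart z)) * g (rpart z).
  rewrite mulr_suml; apply: eq_bigr => i _; rewrite /one_body mulrC ffunE.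
  have := congr1 (@^~ (z (lshift n i)))
    (bopZ cl h_bounded (g (rpart z)) (l2_slice (lpart z) i f2)) => /= <-.
  by congr h; apply/funext => y; rewrite lpart_lupdate rpart_lupdate mulrC.
have -> : \sum_(i < n) one_body h (rshift m i)
    (fun z => f (lpart z) * g (rpart z)) z =
    f (lpart z) * (\sum_(i < n) one_body h i g (rpart z)).
  rewrite mulr_sumr; apply: eq_bigr => i _; rewrite /one_body ffunE.
  have := congr1 (@^~ (z (rshift m i)))
    (bopZ cl h_bounded (f (lpart z)) (l2_slice (rpart z) i g2)) => /= <-.
  by congr h; apply/funext => y; rewrite rpart_rupdate lpart_rupdate.
by ring.
Qed.

End HamiltonianTensor.

Definition preserves_blocks (s : 'S_(m + n)) : bool :=
  [forall i : 'I_m, (s (lshift n i) < m)%N] &&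
  [forall j : 'I_n, (m <= s (rshift m j))%N].

Lemma blocks_perm (s : 'S_(m + n)) : preserves_blocks s ->
  exists (s1 : 'S_m) (s2 : 'S_n),
    (forall i, s (lshift n i) = lshift n (s1 i)) /\
    (forall j, s (rshift m j) = rshift m (s2 j)).
Proof.
move=> /andP[/forallP Pl /forallP Pr].
have [p1 p1E] : exists p : 'I_m -> 'I_m, forall i, s (lshift n i) = lshift n (p i).
  by exists (fun i => Ordinal (Pl i)) => i; apply/val_inj.
have [p2 p2E] : exists p : 'I_n -> 'I_n, forall j, s (rshift m j) = rshift m (p j).
  have H j : (s (rshift m j) - m < n)%N by rewrite ltn_subLR ?Pr.
  by exists (fun j => Ordinal (H j)) => j; apply/val_inj => /=; rewrite subnKC ?Pr.
have i1 : injective p1.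
  by move=> i j e; apply/(@lshift_inj m n)/(@perm_inj _ s); rewrite !p1E e.
have i2 : injective p2.
  by move=> i j e; apply/(@rshift_inj m n)/(@perm_inj _ s); rewrite !p2E e.
by exists (perm i1), (perm i2); split=> k; rewrite permE.
Qed.

(* The sign is the determinant of a block-diagonal permutation matrix. *)
Lemma sign_blocks (s : 'S_(m + n)) (s1 : 'S_m) (s2 : 'S_n) :
  (forall i, s (lshift n i) = lshift n (s1 i)) ->
  (forall j, s (rshift m j) = rshift m (s2 j)) ->
  (-1) ^+ s = (-1) ^+ s1 * (-1) ^+ s2 :> R[i].
Proof.
move=> E1 E2; rewrite -!det_perm -(det_ublock _ 0); congr (\det _).
apply/matrixP => i j; rewrite -(splitK i) -(splitK j).
case: (fintype.split i) (fintype.split j) => i' [] j' /=;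
  rewrite ?block_mxEul ?block_mxEur ?block_mxEdl ?block_mxEdr !mxE ?E1 ?E2.
- by rewrite (inj_eq (@lshift_inj _ _)).
- by rewrite eq_lrshift.
- by rewrite eq_rlshift.
- by rewrite (inj_eq (@rshift_inj _ _)).
Qed.

End Tensor.

(** * Cutting approximate eigenvectors off to boxes *)

Section Truncation.
Context {R : realType}.

Definition box (L : nat) N (w : config N) : bool := [forall i, (`|w i| <= L)%N].

Lemma box_permute L N (s : 'S_N) (w : config N) : box L (permute s w) = box L w.
Proof.
apply/forallP/forallP => H i; last by rewrite ffunE.
by have := H ((s^-1)%g i); rewrite ffunE permKV.
Qed.

Lemma seq_in_box N (s : seq (config N)) :
  exists L, forall w, w \in s -> box L w.
Proof.
elim: s => [|w s [L HL]]; first by exists 0%N.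
exists (maxn L (\max_(i < N) `|w i|)) => v; rewrite inE => vws; apply/forallP => i.
rewrite leq_max; move: vws => /orP[/eqP -> |/HL/forallP ->//].
by rewrite (bigD1 i)//= leq_max leqnn orbT.
Qed.

Lemma sector_cut_box e N L (f : config N -> R[i]) :
  l2_sector e N f -> l2_sector e N (cutoff (@box L N) f).
Proof.
move=> [f2 fs]; split; first exact: l2_cut.
by move=> s z; rewrite /cutoff box_permute; case: ifP; rewrite ?mulr0 ?fs.
Qed.

(** The cutoff uses a box rather than the finite set supplied by [l2_tail], because a box is
    invariant under permutations and the cut vector stays in the sector. *)
Lemma approx_in_box e N (A : (config N -> R[i]) -> config N -> R[i]) z :
  bounded_operator (l2_sector e N) A ->
  (forall d : R, 0 < d -> exists f, [/\ l2_sector e N f, 0 < l2norm f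
    & l2norm (op_shift A z f) <= d * l2norm f]) ->
  forall d : R, 0 < d -> exists f L, [/\ l2_sector e N f, 0 < l2norm f,
    l2norm (op_shift A z f) <= d * l2norm f & forall w, f w != 0 -> box L w].
Proof.
move=> bA H d d0; have cl := closed_subspace_sector (R := R) e N.
have bD := bop_op_shift cl bA z.
have [M M0 HM] := bop_bound bD.
have [f [Vf f0 fd]] := H (d / 4) ltac:(by rewrite divr_gt0).
(* The bound [1 / 2] keeps at least half of the norm of [f]. The other makes the cutoff contribute
   at most [d / 4 * l2norm f] to the error; with the [d / 4] from [f] itself this gives
   [d / 2 * l2norm f], at most [d * l2norm k]. *)
pose t := Num.min (1 / 2) (d / (4 * M)).
have t0 : 0 < t by rewrite lt_min !divr_gt0// mulr_gt0.
have t1 : t <= 1 / 2 by rewrite ge_min lexx.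
have t2 : M * t <= d / 4.
  have : t <= d / (4 * M) by rewrite ge_min lexx orbT.
  by rewrite ler_pdivlMr ?mulr_gt0//; lra.
have f2 := sub_l2 cl Vf.
have [s us fs] := l2_tail f2 (mulr_gt0 t0 f0).
have [L sL] := seq_in_box s.
pose k := cutoff (@box L N) f.
have Vk : l2_sector e N k by exact: sector_cut_box.
have k2 := sub_l2 cl Vk.
have fk : l2norm (fun i => f i - k i) <= t * l2norm f.
  apply: le_trans fs; apply: l2norm_le; last by apply: l2B => //; exact: l2_cut.
  move=> w; rewrite /k /cutoff/=; case: ifP => [_|bw].
    by rewrite subrr sqn0 sqn_ge0.
  by case: ifP => // ws; rewrite sL in bw.
have Vfk := subB cl Vf Vk.
have tri1 : l2norm f <= l2norm k + l2norm (fun i => f i - k i).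
  have := l2norm_triangle k2 (sub_l2 cl Vfk).
  by rewrite (_ : (fun i => _) = f)//; apply/funext => w; rewrite addrC subrK.
have tri2 : l2norm (op_shift A z k) <=
    l2norm (op_shift A z f) + l2norm (op_shift A z (fun i => f i - k i)).
  have := l2norm_triangleB (sub_l2 cl (bop_sub bD Vf)) (sub_l2 cl (bop_sub bD Vfk)).
  rewrite (bopB bD)// (_ : (fun i => _) = op_shift A z k)//.
  by apply/funext => w; rewrite opprB addrC subrK.
have hM := HM _ Vfk.
have h1 : t * l2norm f <= 1 / 2 * l2norm f by rewrite ler_wpM2r// ltW.
have h2 : M * l2norm (fun i => f i - k i) <= M * (t * l2norm f).
  by rewrite ler_wpM2l// ltW.
have h3 : M * (t * l2norm f) <= d / 4 * l2norm f.
  by rewrite mulrA ler_wpM2r// ltW.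
have h4 : d * l2norm f <= d * (2 * l2norm k) by apply: ler_wpM2l; [exact: ltW|lra].
exists k, L; split=> //.
- by lra.
- by lra.
by move=> w; rewrite /k /cutoff; case: ifP => //; rewrite eqxx.
Qed.

End Truncation.

(** * Translating a whole cluster *)

Section Translate.
Context {R : realType}.

Definition shift_config (a : int) N (w : config N) : config N := [ffun j => w j - a].

Lemma shift_config_bij a N : bijective (@shift_config a N).
Proof.
by exists (@shift_config (- a) N) => w; apply/ffunP => j;
  rewrite !ffunE ?opprK ?subrK ?addrK.
Qed.

(** All coordinates move together: each slice of the shifted function is a [translation] of a slice
    of [f], and the differences [z i - z j] are unchanged. *)
Lemma hamiltonian_translate (h : (int -> R[i]) -> int -> R[i]) Q a N
    (f : config N -> R[i]) :
  translation_invariant h -> l2 f ->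
  hamiltonian h Q N (f \o shift_config a (N := N)) =
  hamiltonian h Q N f \o shift_config a (N := N).
Proof.
move=> h_transl f2; apply/funext => z /=; rewrite !hamiltonianE; congr +%R.
  apply: eq_bigr => i _; rewrite /one_body.
  have := congr1 (@^~ (z i)) (h_transl a _ (l2_slice (shift_config a z) i f2)).
  rewrite /translation ffunE => <-; congr h; apply/funext => y /=.
  by congr f; apply/ffunP => k; rewrite !ffunE; case: eqP.
congr ((_)%:C%C * _); apply: eq_bigr => i _; apply: eq_bigr => j _.
by rewrite !ffunE; congr (Q `|_|%N); lia.
Qed.

Lemma sector_translate e a N (f : config N -> R[i]) :
  l2_sector e N f -> l2_sector e N (f \o shift_config a (N := N)).
Proof.
move=> [f2 fs]; split; first exact: (l2_comp_inj (bij_inj (shift_config_bij a N))).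
move=> s z /=; rewrite -fs; congr f.
by apply/ffunP => i; rewrite !ffunE.
Qed.

End Translate.

(** * Symmetrization *)

Section Symmetrization.
Context {R : realType}.

Section Fixed.
Context {I : choiceType} {K : Type}.
Variables (V : set (I -> R[i])) (cV : closed_subspace V).
Variables (c : K -> R[i]) (F : K -> I -> R[i]).
Hypothesis VF : forall k, V (F k).

Lemma sub_lincomb (r : seq K) : V (fun i => \sum_(k <- r) c k * F k i).
Proof.
elim: r => [|k r IH].
  rewrite (_ : (fun i => _) = (fun=> 0)); first exact: sub0 cV.
  by apply/funext => i; rewrite big_nil.
rewrite (_ : (fun i => _) = fun i => c k * F k i + \sum_(k <- r) c k * F k i).
  exact: sub_lin.
by apply/funext => i; rewrite big_cons.
Qed.

Lemma bop_lincomb A (r : seq K) : bounded_operator V A ->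
  A (fun i => \sum_(k <- r) c k * F k i) = (fun i => \sum_(k <- r) c k * A (F k) i).
Proof.
move=> bA; elim: r => [|k r IH].
  rewrite (_ : (fun i => _) = (fun=> 0)); last by apply/funext => i; rewrite big_nil.
  by rewrite (bop0 cV bA); apply/funext => i; rewrite big_nil.
rewrite (_ : (fun i => _) = fun i => c k * F k i + \sum_(k <- r) c k * F k i).
  rewrite (bop_lin bA)//; last exact: sub_lincomb.
  by rewrite IH; apply/funext => i; rewrite big_cons.
by apply/funext => i; rewrite big_cons.
Qed.

Lemma l2norm_lincomb_le (x : R) (r : seq K) :
  (forall k, sqn (c k) = 1) -> (forall k, l2norm (F k) <= x) ->
  l2norm (fun i => \sum_(k <- r) c k * F k i) <= (size r)%:R * x.
Proof.
move=> c1 Fx; elim: r => [|k r IH].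
  rewrite (_ : (fun i => _) = (fun=> 0)) ?l2norm0 ?mul0r//.
  by apply/funext => i; rewrite big_nil.
rewrite (_ : (fun i => _) = fun i => c k * F k i + \sum_(k <- r) c k * F k i).
  apply: le_trans (l2norm_triangle _ _) _.
  - by apply: (sub_l2 cV); apply: subZ.
  - by apply: (sub_l2 cV); exact: sub_lincomb.
  rewrite l2normZ; last exact: (sub_l2 cV).
  by rewrite c1 sqrtr1 mul1r /= -natr1 mulrDl mul1r addrC lerD.
by apply/funext => i; rewrite big_cons.
Qed.

End Fixed.

Variables (e : bool) (N : nat).

Definition sector_sign (s : 'S_N) : R[i] := (-1) ^+ (e && s).

Lemma sqn_sector_sign s : sqn (sector_sign s) = 1.
Proof.
by rewrite -[sector_sign s]mulr1 sqn_sign /sqn/= expr1n expr0n addr0.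
Qed.

Lemma sector_signM s t : sector_sign (s * t)%g = sector_sign s * sector_sign t.
Proof. by rewrite /sector_sign odd_permM -signr_addb; case: e. Qed.

Lemma sector_sign_sqr s : sector_sign s * sector_sign s = 1.
Proof. by rewrite /sector_sign -expr2 sqrr_sign. Qed.

(** Left without a normalizing factor, since only ratios of norms matter; the lower bound for
    separated clusters then has constant 1. *)
Definition symmetrize (f : config N -> R[i]) : config N -> R[i] :=
  fun z => \sum_(s : 'S_N) sector_sign s * (f \o permute s) z.

Lemma l2_permute (s : 'S_N) (f : config N -> R[i]) : l2 f -> l2 (f \o permute s).
Proof. exact/l2_comp_inj/bij_inj/permute_bij. Qed.

Lemma sector_symmetrize f : l2 f -> l2_sector e N (symmetrize f).
Proof.
move=> f2; split.
  apply: (sub_lincomb (@closed_subspace_l2 R _)) => s; exact: l2_permute.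
move=> t z; rewrite -/(sector_sign t) /symmetrize mulr_sumr.
rewrite [RHS](reindex_inj (mulIg t)); apply: eq_bigr => s _ /=.
rewrite permuteM sector_signM [_ * sector_sign t]mulrC !mulrA.
by rewrite sector_sign_sqr mul1r.
Qed.

(** The Hamiltonian commutes with permutations, so all terms have error vectors of equal norm and
    the triangle inequality suffices. *)
Lemma l2norm_op_shift_symmetrize (h : (int -> R[i]) -> int -> R[i]) Q z f :
  bounded_operator l2 (hamiltonian h Q N) -> l2 f ->
  l2norm (op_shift (hamiltonian h Q N) z (symmetrize f)) <=
  #|'S_N|%:R * l2norm (op_shift (hamiltonian h Q N) z f).
Proof.
move=> bH f2; have cl := @closed_subspace_l2 R (config N).
have bD := bop_op_shift cl bH z.
have pf2 (s : 'S_N) : l2 (f \o permute s) by exact: l2_permute.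
rewrite (_ : symmetrize f = fun w =>
  \sum_(s <- enum 'S_N) sector_sign s * (f \o permute s) w); last first.
  by apply/funext => w; rewrite big_enum.
have -> := bop_lincomb cl sector_sign pf2 (enum 'S_N) bD.
rewrite cardE; apply: (l2norm_lincomb_le cl
  (F := fun s => op_shift (hamiltonian h Q N) z (f \o permute s))).
- by move=> s; exact: (bop_sub bD).
- exact: sqn_sector_sign.
move=> s; rewrite -[leRHS](l2norm_comp_bij _ (permute_bij s)).
rewrite (_ : op_shift _ _ _ = op_shift (hamiltonian h Q N) z f \o permute s)//.
by apply/funext => w; rewrite /op_shift/= hamiltonian_permute.
Qed.

End Symmetrization.

(** * Distant clusters and the sum of spectra *)

Section Main.
Context {R : realType}.
Variables (h : (int -> R[i]) -> int -> R[i]) (Q : nat -> R).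
Hypotheses (h_bounded : bounded_operator l2 h) (h_selfadj : self_adjoint h).
Hypothesis h_transl : translation_invariant h.
Hypothesis Q_lim : Q r @[r --> \oo] --> (0 : R).

Lemma potential_bounded : exists M, forall r, `|Q r| <= M.
Proof.
have [M [_ HM]] := cvg_seq_bounded (cvgP _ Q_lim).
by exists (M + 1) => r; apply: HM; rewrite ?ltrDl.
Qed.

Lemma potential_small (d : R) : 0 < d ->
  exists r0, forall r, (r0 <= r)%N -> `|Q r| <= d.
Proof.
move=> d0; have /cvgrPdist_le/(_ d d0)[r0 _ H] := Q_lim.
by exists r0 => r /H /=; rewrite sub0r normrN.
Qed.

Section SameSector.
Variables (e : bool) (m n L : nat) (f : config m -> R[i]) (g : config n -> R[i]).
Hypotheses (Vf : l2_sector e m f) (Vg : l2_sector e n g).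
Hypotheses (fL : forall w, f w != 0 -> box L w).
Variable a : nat.
Hypothesis gL : forall w, g w != 0 -> box L (shift_config a%:Z w).

Lemma tensor_support z : tensor f g z != 0 ->
  (forall i, (`|z (lshift n i)| <= L)%N) /\
  (forall j, (`|z (rshift m j) - a%:Z| <= L)%N).
Proof.
rewrite /tensor mulf_eq0 => /norP[/fL/forallP H1 /gL/forallP H2].
by split=> i; [have := H1 i|have := H2 i]; rewrite !ffunE.
Qed.

(** A pointwise comparison stands in for orthogonality. For a block-preserving [s], its sign is the
    product of the signs on the blocks, and these cancel against the signs from [f] and [g]. On the
    support the sum is therefore [tensor f g z] times the number of such [s], which is positive
    because of the identity. *)
Lemma symmetrize_tensor_ge z : (L.*2 < a)%N ->
  sqn (tensor f g z) <= sqn (symmetrize e (tensor f g) z).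
Proof.
move=> La; have [->|fgz] := eqVneq (tensor f g z) 0.
  by rewrite sqn0 sqn_ge0.
have [zl zr] := tensor_support fgz.
have term (s : 'S_(m + n)) : sector_sign e s * (tensor f g \o permute s) z =
    if preserves_blocks s then tensor f g z else 0.
  case: ifPn => [/blocks_perm[s1 [s2 [E1 E2]]]|].
    have -> : sector_sign e s = sector_sign e s1 * sector_sign e s2 :> R[i].
      by rewrite /sector_sign; case: (e); rewrite ?mul1r//=; exact: sign_blocks.
    have sl : lpart (permute s z) = permute s1 (lpart z).
      by apply/ffunP => i; rewrite !ffunE E1.
    have sr : rpart (permute s z) = permute s2 (rpart z).
      by apply/ffunP => i; rewrite !ffunE E2.
    rewrite /= /tensor sl sr Vf.2 Vg.2 -/(sector_sign e s1) -/(sector_sign e s2).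
    have := sector_sign_sqr (R := R) e s1; have := sector_sign_sqr (R := R) e s2.
    move: (sector_sign e s1) (sector_sign e s2) => x y yy xx.
    rewrite (_ : _ * _ = (x * x) * (y * y) * (f (lpart z) * g (rpart z)));
      last by ring.
    by rewrite xx yy !mul1r.
  (* If the term is nonzero, [permute s z] also lies in the support. An index sent to the other
     block would put one coordinate within [L] of both 0 and [a], against [L.*2 < a]. *)
  apply: contraNeq; rewrite mulf_eq0 => /norP[_ /= /tensor_support[sl sr]].
  apply/andP; split; apply/forallP => i.
    rewrite ltnNge; apply/negP => le.
    have lt : (s (lshift n i) - m < n)%N by rewrite ltn_subLR.
    have e1 : s (lshift n i) = rshift m (Ordinal lt).
      by apply/val_inj; rewrite /= subnKC.
    by have := sl i; rewrite ffunE e1; have := zr (Ordinal lt); lia.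
  rewrite leqNgt; apply/negP => lt.
  have e1 : s (rshift m i) = lshift n (Ordinal lt) by exact/val_inj.
  by have := sr i; rewrite ffunE e1; have := zl (Ordinal lt); lia.
rewrite /symmetrize (eq_bigr _ (fun s _ => term s)) -big_mkcond/= sumr_const.
rewrite -mulr_natr sqnM ler_peMr ?sqn_ge0//.
have -> k : k%:R = k%:R%:C%C :> R[i] by rewrite rmorph_nat.
rewrite sqnC exprn_ege1// ler1n; apply/card_gt0P; exists 1%g.
rewrite unfold_in; apply/andP; split; apply/forallP => i; rewrite perm1/=.
  exact: ltn_ord.
exact: leq_addr.
Qed.

Lemma cross_energy_le (d : R) r0 z : (L.*2 + r0 <= a)%N ->
  (forall r, (r0 <= r)%N -> `|Q r| <= d) -> tensor f g z != 0 ->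
  `|cross_energy Q z| <= (m * n)%:R * d.
Proof.
move=> La Qd /tensor_support[zl zr].
apply: (@le_trans _ _ (\sum_(i < m) \sum_(j < n) d)).
  apply: le_trans (ler_norm_sum _ _ _) _; apply: ler_sum => i _.
  apply: le_trans (ler_norm_sum _ _ _) _; apply: ler_sum => j _.
  by apply: Qd; have := zl i; have := zr j; lia.
by rewrite !sumr_const !card_ord -mulrnA mulr_natl mulnC.
Qed.

End SameSector.

Lemma spectrum_sum e m n z w :
  spectrum (l2_sector e m) (hamiltonian h Q m) z ->
  spectrum (l2_sector e n) (hamiltonian h Q n) w ->
  spectrum (l2_sector e (m + n)) (hamiltonian h Q (m + n)) (z + w).
Proof.
move=> sz sw; have [QM QMP] := potential_bounded.
have HS N := hamiltonian_sector h_bounded h_selfadj QMP e N.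
have HB N := (bounded_symmetric_hamiltonian h_bounded h_selfadj QMP N).1.
have cl N := closed_subspace_sector (R := R) e N.
have c2 N := @closed_subspace_l2 R (config N).
have approx N x : spectrum (l2_sector e N) (hamiltonian h Q N) x ->
    forall d : R, 0 < d -> exists f L, [/\ l2_sector e N f, 0 < l2norm f,
      l2norm (op_shift (hamiltonian h Q N) x f) <= d * l2norm f
      & forall w, f w != 0 -> box L w].
  move=> sx; apply: approx_in_box; first exact: (HS N).1.
  exact: (spectrum_approx (cl N) (HS N).1 (HS N).2).
apply: (approx_spectrum (cl _) (HS _).1) => d d0.
(* The total loss: one unit of error from each cluster, one from each of the [m * n] cross pairs,
   all multiplied by the cost of symmetrization. *)
pose k : R := #|'S_(m + n)|%:R * (2 + (m * n)%:R).
have k0 : 0 < k.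
  apply: mulr_gt0; first by rewrite ltr0n; apply/card_gt0P; exists 1%g.
  by have := ler0n R (m * n); lra.
pose d1 := d / k; have d10 : 0 < d1 by rewrite divr_gt0.
have [f [L1 [Vf f0 fd fL1]]] := approx _ _ sz d1 d10.
have [g0 [L2 [Vg0 g00 g0d gL2]]] := approx _ _ sw d1 d10.
have [r0 Qr0] := potential_small d10.
(* Coordinates in different clusters are then more than [r0] apart, which makes the interaction
   small; the successor also gives the strict [L.*2 < a] when [r0 = 0]. *)
pose L := maxn L1 L2; pose a := (L.*2 + r0).+1.
pose g := g0 \o @shift_config a%:Z n.
have Vg : l2_sector e n g by exact: sector_translate.
have f2 := Vf.1; have g2 := Vg.1.
have nog : l2norm g = l2norm g0 by exact/l2norm_comp_bij/shift_config_bij.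
have gd : l2norm (op_shift (hamiltonian h Q n) w g) <= d1 * l2norm g.
  rewrite nog; apply: le_trans g0d.
  rewrite -[leRHS](l2norm_comp_bij _ (shift_config_bij a%:Z n)).
  rewrite (_ : op_shift _ w g =
    op_shift (hamiltonian h Q n) w g0 \o shift_config a%:Z (N := n))//.
  apply/funext => v.
  by rewrite /op_shift (hamiltonian_translate Q a%:Z h_transl Vg0.1).
have box_le N' k1 k2 (v : config N') : (k1 <= k2)%N -> box k1 v -> box k2 v.
  by move=> le12 /forallP H; apply/forallP => i; apply: leq_trans le12.
have fL v : f v != 0 -> box L v by move=> /fL1; apply: box_le; exact: leq_maxl.
have gL v : g v != 0 -> box L (shift_config a%:Z v).
  by move=> /gL2; apply: box_le; exact: leq_maxr.
pose F := tensor f g.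
have F2 : l2 F by exact: l2_tensor.
have Fn : l2norm F = l2norm f * l2norm g by exact: l2norm_tensor.
have F0 : 0 < l2norm F by rewrite Fn nog mulr_gt0.
have sF2 := (sector_symmetrize e F2).1.
have Fu : l2norm F <= l2norm (symmetrize e F).
  apply: l2norm_le => // v; apply: (symmetrize_tensor_ge Vf Vg fL gL).
  by rewrite /a; lia.
pose mn : R := (m * n)%:R.
have mn0 : 0 <= mn by exact: ler0n.
have [C2 Cd] : l2 (fun v => (cross_energy Q v)%:C%C * F v) /\
    l2norm (fun v => (cross_energy Q v)%:C%C * F v) <= mn * d1 * l2norm F.
  apply: l2norm_mul_le => //; first by rewrite mulr_ge0// ltW.
  move=> v; apply: (cross_energy_le fL gL _ Qr0).
  by rewrite /a; lia.
have fs2 : l2 (op_shift (hamiltonian h Q m) z f).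
  exact: (bop_sub (bop_op_shift (c2 m) (HB m) z)).
have gs2 : l2 (op_shift (hamiltonian h Q n) w g).
  exact: (bop_sub (bop_op_shift (c2 n) (HB n) w)).
have FE : op_shift (hamiltonian h Q (m + n)) (z + w) F = fun v =>
    (tensor (op_shift (hamiltonian h Q m) z f) g v +
     tensor f (op_shift (hamiltonian h Q n) w g) v) +
    (cross_energy Q v)%:C%C * F v.
  apply/funext => v; rewrite {1}/op_shift hamiltonian_tensor//.
  by rewrite /F /tensor /op_shift; ring.
have Fs : l2norm (op_shift (hamiltonian h Q (m + n)) (z + w) F) <=
    (2 + mn) * d1 * l2norm F.
  rewrite FE; apply: le_trans (l2norm_triangle _ C2) _.
    by apply: l2D; exact: l2_tensor.
  have := l2norm_triangle (l2_tensor fs2 g2) (l2_tensor f2 gs2).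
  rewrite (l2norm_tensor fs2 g2) (l2norm_tensor f2 gs2).
  have := ler_wpM2r (l2norm_ge0 g) fd; have := ler_wpM2l (l2norm_ge0 f) gd.
  by move: Cd; rewrite Fn; lra.
exists (symmetrize e F); split.
- exact: sector_symmetrize.
- exact: lt_le_trans F0 Fu.
apply: le_trans (l2norm_op_shift_symmetrize e _ (HB _) F2) _.
apply: le_trans (ler_wpM2l (ler0n _ _) Fs) _.
have -> : #|'S_(m + n)|%:R * ((2 + mn) * d1 * l2norm F) = d * l2norm F.
  have dk : k * d1 = d by rewrite /d1 mulrC divfK ?gt_eqF.
  by rewrite -[in RHS]dk /k -/mn !mulrA.
by apply: ler_wpM2l => //; exact: ltW.
Qed.

End Main.

Theorem proposition6p2 (R : realType)
    (h : (int -> R[i]) -> int -> R[i]) (Q : nat -> R)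
    (h_bounded : bounded_operator l2 h)
    (h_selfadj : self_adjoint h)
    (h_transl : translation_invariant h)
    (Q_lim : Q r @[r --> \oo] --> (0 : R))
    (N m : nat) (m_range : (1 <= m <= N - 1)%N) :
  sumset (spectrum (l2s m) (hamiltonian h Q m))
         (spectrum (l2s (N - m)) (hamiltonian h Q (N - m)))
    `<=` spectrum (l2s N) (hamiltonian h Q N)
  /\
  sumset (spectrum (l2a m) (hamiltonian h Q m))
         (spectrum (l2a (N - m)) (hamiltonian h Q (N - m)))
    `<=` spectrum (l2a N) (hamiltonian h Q N).
Proof.
(* The truncated subtraction is exact by [m_range]; replacing [N] by [m + n] gives the
   configurations the block form used by [tensor]. *)
have EN : N = (m + (N - m))%N by lia.
move: (N - m)%N EN m_range => n -> _; rewrite !l2sE !l2aE.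
by split=> _ [z sz [w sw <-]]; exact: spectrum_sum.
Qed.
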